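(* Let $A\subset\mathbb{C}$ be a finite set with $0\notin A$ and $|A|>1$, and let $$R[A]:=\left\{\frac{a_1-a}{a_2-a}\ :\ a,a_1,a_2\in A,\ a_2\neq a\right\}.$$ Then there are two sets $R',R''\subseteq R[A]$ with $|R'|,|R''|\ge |R[A]|/2$ such that $$\mathsf{E}^\times(R')\lesssim |R'|^{3-1/4}\qquad\text{and}\qquad \mathsf{E}^+(R'')\lesssim |R''|^{3-1/4}.$$
   Context: For a finite set $X\subset\mathbb{C}$, $\mathsf{E}^+(X)$ is the number of $(x_1,x_2,x_3,x_4)\in X^4$ with $x_1+x_3=x_2+x_4$ (additive energy), and $\mathsf{E}^\times(X)$ is the number of $(x_1,x_2,x_3,x_4)\in X^4$ with $x_1x_3=x_2x_4$ (multiplicative energy). $U\lesssim V$ means $U\le C_0(\log|A|)^{C_0}V$ for some absolute constant $C_0>0$ (independent of $A$). *)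

(* Defs.v *)
From HB Require Import structures.
From mathcomp Require Import all_boot all_order all_algebra.
From mathcomp Require Import finmap complex.
From mathcomp Require Import reals exp.

Set Implicit Arguments.
Unset Strict Implicit.
Unset Printing Implicit Defensive.

Import Order.TTheory GRing.Theory Num.Theory.

Local Open Scope ring_scope.

Definition additive_energy (K : nzRingType) (X : {fset K}) : nat :=
  #|` [fset q in X `*` X `*` X `*` X |
        let: (x1, x2, x3, x4) := q in (x1 + x3 == x2 + x4)%R] |%fset.

Definition multiplicative_energy (K : nzRingType) (X : {fset K}) : nat :=
  #|` [fset q in X `*` X `*` X `*` X |
        let: (x1, x2, x3, x4) := q in (x1 * x3 == x2 * x4)%R] |%fset.

Definition ratio_set (K : fieldType) (A : {fset K}) : {fset K} :=
  [fset (let: (a, a1, a2) := t in ((a1 - a) / (a2 - a))%R) |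
     t in A `*` A `*` A & (let: (a, a1, a2) := t in a2 != a)]%fset.

(* The logarithm is taken to base 2, so that it is at least 1 for n > 1: the
   bound below is then nondecreasing in C, and two instances of it can always
   be given a common constant.  With the natural logarithm, C (ln 2)^C is at
   most 1.004 for every C > 0, so the case n = 2 would pin C down to a small
   interval, contrary to the role of C as an unspecified constant. *)
Definition log2 (R : realType) (x : R) : R := ln x / ln 2.

Definition polylog_le (R : realType) (C : R) (n : nat) (U V : R) : Prop :=
  U <= C * (log2 n%:R) `^ C * V.

(* Main.v *)
(* Write R = R[A]. Both x |-> 1 - x and (away from 0) x |-> 1 / x preserve
   R. If a subset of R has large multiplicative energy, a dyadic
   decomposition gives a piece A' whose elements are all of the form a = p
   / c, with c in R, for many p in a small set P; then (1 - a) b = x reads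
   as the incidence of the point (p, 1 / b) with the line of slope
   depending on (c, x), and an incidence bound makes the multiplicative
   energy of 1 - A' with R small. Taking a maximal union B of such pieces,
   either B exceeds half of R, and 1 - B has small energy, or the
   complement of B has small energy. For the additive energy the same
   argument runs with a = p - c and 1 / a + b = x, where lines are
   replaced by the hyperbolas (p - c) (x - b) = 1.

   The incidence bound is a Szemeredi-Trotter estimate for cartesian
   products in C^2, valid for lines and for these hyperbolas. Each factor
   is partitioned, greedily in a hierarchy of grids, into classes of
   bounded size. Every small disc lies inside one cell of comparable size
   of one of four shifted grids; so, for a suitable pair of grids, the
   points of a curve meet only O(r) pairs of classes when each factor has
   r classes. A curve with many more points than that has many pairs of
   points in a common pair of classes, and two points of the product lie
   on at most two curves. *)
Require Import Defs.
From mathcomp Require Import all_boot all_order all_algebra.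
From mathcomp Require Import finmap complex.
From mathcomp Require Import boolp reals exp.
From mathcomp Require Import zify ring lra.

Set Implicit Arguments.
Unset Strict Implicit.
Unset Printing Implicit Defensive.

Import Order.TTheory GRing.Theory Num.Theory.

Local Open Scope ring_scope.

(** * Finite counting and greedy partitions *)

(** The exponent comes from balancing two bounds. Let n be the size of R. If a set has energy above
    n^(3-d), the dyadic choices and the incidence bound give, up to logarithms, energy at most
    |A'|^2 n^(1/2+d) between R and the image of its piece A'. For |A'| = n this equals n^(3-d)
    exactly when d = 1/4. The bound has to be quadratic in |A'|: the square root of this energy is
    an l^2 norm, hence subadditive over disjoint pieces, and the number of pieces then costs
    nothing.

    In the incidence bound the difficulty is that classes live at unrelated scales. Of the two class
    cells at a point of a curve, the one that is smaller along the curve should determine the other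
    up to bounded information, which is stored in a finite label. On a hyperbola this fails for
    cells as large as the distance to its centre. There a large cell contains the coordinate of the
    centre, so that a class is known from its level; when both cells are large, the pairs of levels
    form a staircase, which has few steps. *)

Section Counting.
Local Open Scope nat_scope.

Lemma size_undup_map_factor (T : eqType) (Q1 Q2 : eqType) (g : T -> Q1)
    (h : T -> Q2) (s : seq T) :
  {in s &, forall p p', h p = h p' -> g p = g p'} ->
  size (undup (map g s)) <= size (undup (map h s)).
Proof.
elim: s => // x s IHs gh /=.
have {}IHs : size (undup (map g s)) <= size (undup (map h s)).
  by apply: IHs => p p' ps p's; apply: gh; rewrite inE ?ps ?p's orbT.
case: ifP => gx; case: ifP => hx //=; first by rewrite ltnW.
case/mapP: hx => y ys hxy; suff : g x \in map g s by rewrite gx.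
by rewrite (gh x y) ?map_f // inE ?eqxx ?ys ?orbT.
Qed.

Lemma size_uniq_card (F : finType) (s : seq F) : uniq s -> size s <= #|F|.
Proof. by move/card_uniqP=> <-; apply: max_card. Qed.

Lemma sum_eq_uniq (T : eqType) (s : seq T) (y : T) :
  uniq s -> \sum_(x <- s) (y == x : nat) = (y \in s).
Proof.
elim: s => [|x s IHs] /=; first by rewrite big_nil.
case/andP=> xs us; rewrite big_cons IHs // inE.
by case: eqVneq => // ->; rewrite (negbTE xs).
Qed.

Lemma sum_count (T Q : eqType) (s : seq T) (C : seq Q) (g : T -> Q) :
  uniq C -> \sum_(c <- C) count (fun p => g p == c) s <= size s.
Proof.
move=> uC; under eq_bigr do rewrite -sum1_count big_mkcond /=.
rewrite exchange_big /= -sum1_size leq_sum // => p _.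
rewrite (eq_bigr (fun c => (g p == c : nat))).
  by rewrite sum_eq_uniq //; case: (_ \in _).
by move=> c _; case: (_ == _).
Qed.

(** An entry is either the last of its class, counted by the distinct values, or collides with a
    later entry. This turns a surplus of points on a curve into pairs of points in common
    classes. *)
Lemma size_undup_le_pairs (T Q : eqType) (s : seq T) (g : T -> Q) :
  uniq s ->
  size s <= size (undup (map g s)) +
    \sum_(u <- s) \sum_(v <- s) ((u != v) && (g u == g v) : nat).
Proof.
elim: s => [|x s IHs] //= /andP[xs us].
rewrite !big_cons eqxx /= add0n.
set B := \sum_(v <- s) _; set A := \sum_(u <- s) _.
have HA : \sum_(u <- s) \sum_(v <- s) ((u != v) && (g u == g v) : nat) <= A.
  by apply: leq_sum => u _; rewrite big_cons leq_addl.
have := IHs us; case: ifP => gx /=; last by move=> ?; lia.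
case/mapP: gx => y ys gxy.
have : 0 < B; last by move=> ? ?; lia.
rewrite /B (big_rem y) //= gxy eqxx andbT.
by case: (eqVneq x y) => // xy; rewrite xy ys in xs.
Qed.

Lemma sum_le1 (T : eqType) (s : seq T) (a : pred T) : uniq s ->
  {in s &, forall x y, a x -> a y -> x = y} -> \sum_(x <- s) (a x : nat) <= 1.
Proof.
elim: s => [|x s IH] /=; first by rewrite big_nil.
case/andP=> xs us H; rewrite big_cons.
case ax: (a x); last first.
  by apply: IH => // y z ys zs; apply: H; rewrite inE ?ys ?zs orbT.
rewrite big_seq big1 // => y ys; case ay: (a y) => //.
by rewrite (H x y) ?inE ?eqxx ?ys ?orbT // ys in xs.
Qed.

Lemma sum_eq2_le (T : eqType) (s : seq T) (y z : T) : uniq s ->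
  \sum_(x <- s) ((y == x) && (z == x) : nat) <= (y == z).
Proof.
move=> us; case: eqVneq => [<-|yz]; first by apply: sum_le1 => // u v _ _
  /andP[/eqP<- _] /andP[/eqP<-].
by rewrite big1 // => x _; case: eqP => // <-; rewrite eq_sym (negbTE yz).
Qed.

Lemma dyadic_pigeonhole (T : eqType) (s : seq T) (w g : T -> nat) (l : nat) :
  0 < l -> {in s, forall x, w x < 2 ^ l} ->
  {in s, forall x, w x = 0 -> g x = 0} ->
  exists j, \sum_(x <- s) g x <= l * \sum_(x <- s | 2 ^ j <= w x < 2 ^ j.+1) g
    x.
Proof.
move=> l0 wl g0.
pose F j := \sum_(x <- s | 2 ^ j <= w x < 2 ^ j.+1) g x.
have tot : \sum_(x <- s) g x <= \sum_(j < l) F j.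
  rewrite (eq_bigr (fun j : 'I_l => \sum_(x <- s)
      if 2 ^ j <= w x < 2 ^ j.+1 then g x else 0)); last first.
    by move=> j _; rewrite /F big_mkcond.
  rewrite exchange_big /= big_seq [leqRHS]big_seq; apply: leq_sum => x xs.
  have [w0|w0] := posnP (w x); first by rewrite g0.
  have jl : trunc_log 2 (w x) < l.
    rewrite -(ltn_exp2l _ _ (ltnSn 1)); apply: leq_ltn_trans (wl x xs).
    exact: trunc_logP.
  by rewrite (bigD1 (Ordinal jl)) //= trunc_logP // trunc_log_ltn // leq_addr.
case: (@arg_maxnP _ (Ordinal l0) xpredT (fun j => F j) isT) => j _ jmax.
exists j; apply: leq_trans tot _.
apply: (@leq_trans (\sum_(i < l) F j)); first by apply: leq_sum => i _;
  apply: jmax.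
by rewrite sum_nat_const card_ord.
Qed.

Lemma sum_sub_uniq (T : eqType) (s1 s2 : seq T) (F : T -> nat) :
  uniq s1 -> {subset s1 <= s2} -> \sum_(x <- s1) F x <= \sum_(x <- s2) F x.
Proof.
elim: s1 s2 => [|x s1 IH] s2 /=; first by rewrite big_nil.
case/andP=> xs1 us1 s12; rewrite big_cons [leqRHS](big_rem x) ?s12 ?mem_head
  //=.
rewrite leq_add2l; apply: IH => // y ys1.
have yx : y != x by apply: contraNneq xs1 => <-.
have : y \in s2 by rewrite s12 // inE ys1 orbT.
by rewrite (perm_mem (perm_to_rem (s12 x (mem_head _ _)))) inE (negbTE yx).
Qed.

End Counting.

(** * Greedy classes in a hierarchy of partitions *)

Section Cutting.
Local Open Scope nat_scope.

Variables (T Q : eqType) (F : finType) (P : seq T) (q : nat -> T -> Q).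
Variables (res : nat -> T -> F) (top : T -> F) (K N : nat).

Hypothesis uP : uniq P.
Hypothesis K0 : 0 < K.
Hypothesis q0_inj : {in P &, injective (q 0)}.
Hypothesis resP : forall n p p',
  q n.+1 p = q n.+1 p' -> res n p = res n p' -> q n p = q n p'.
Hypothesis topP : {in P &, forall p p', top p = top p' -> q N p = q N p'}.

(* Greedy selection: at level [m], a cell holding more than [K] unassigned
   points becomes a class; [unassigned n p] says that [p] belongs to no class
   selected at a level below [n]. *)
Fixpoint unassigned n p : bool :=
  if n is m.+1 then
    unassigned m p &&
    (count (fun p' => (q m p' == q m p) && unassigned m p') P <= K)
  else true.

(** The default value [N] of [find] matters: points selected at no lower level are grouped by their
    cell of level [N], however few they are. *)
Definition level p := find (fun n => ~~ unassigned n.+1 p) (iota 0 N).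

Definition class p := (level p, q (level p) p).

Lemma unassigned_le m n p : m <= n -> unassigned n p -> unassigned m p.
Proof.
move=> /subnK <-; elim: (n - m) => //= k IHk /andP[+ _]; exact: IHk.
Qed.

Lemma level_le p : level p <= N.
Proof. by rewrite -[leqRHS](size_iota 0) find_size. Qed.

Lemma unassigned_level p : unassigned (level p) p.
Proof.
case E: (level p) => [//|m].
have mN : m < N by have := level_le p; rewrite E.
have := @before_find _ 0 (fun n => ~~ unassigned n.+1 p) (iota 0 N) m.
rewrite -/(level p) E ltnSn nth_iota // add0n => /(_ isT) /negbFE.
exact.
Qed.

Lemma level_lt_unassigned p : level p < N -> ~~ unassigned (level p).+1 p.
Proof.
move=> lpN.
have := @nth_find _ 0 (fun n => ~~ unassigned n.+1 p) (iota 0 N).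
by rewrite has_find size_iota -/(level p) lpN nth_iota // => /(_ isT).
Qed.

Lemma level_leP n p : n < N -> ~~ unassigned n.+1 p -> level p <= n.
Proof.
move=> nN; apply: contraR; rewrite -ltnNge => lt.
exact: unassigned_le lt (unassigned_level p).
Qed.

(** If [p] is selected at its level, its cell there is overfull, so every point of that cell still
    unassigned is selected with it. *)
Lemma level_cell p p' : q (level p) p' = q (level p) p -> level p' <= level p.
Proof.
move=> qpp'; have [lpN|] := ltnP (level p) N; last exact/leq_trans/level_le.
have [up'|up'] := boolP (unassigned (level p) p').
  apply: level_leP => //=; rewrite up' /=.
  have /= := level_lt_unassigned lpN; rewrite unassigned_level /=.
  by rewrite qpp'.
by apply: contraR up'; rewrite -ltnNge => /ltnW /unassigned_le; apply;
  apply: unassigned_level.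
Qed.

(** A point unassigned at level [n.+1] comes from a cell of level [n] with at most [K] unassigned
    points, and [resP] allows at most [#|F|] such cells inside one cell of level [n.+1]. At level 0
    a cell holds a single point. *)
Lemma count_unassigned n p : p \in P ->
  count (fun p' => (q n p' == q n p) && unassigned n p') P <= #|F| * K.
Proof.
move=> pP.
have F0 : 0 < #|F| by apply/card_gt0P; exists (res 0 p).
case: n => [|n].
  apply: (@leq_trans 1); last by rewrite muln_gt0 F0.
  rewrite (@eq_in_count _ _ (pred1 p)) ?count_uniq_mem ?pP // => p' p'P /=.
  by rewrite andbT; apply/eqP/eqP => [/q0_inj->|->].
rewrite -sum1_count (partition_big (res n) xpredT) //=.
rewrite -sum_nat_const leq_sum // => i _.
rewrite sum1_count.
set a := fun _ => _.
have [/hasP[p0 p0P ap0]|ha] := boolP (has a P); last first.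
  by move: ha; rewrite has_count -leqNgt => /leq_trans; apply.
have /andP[/andP[/eqP q0 /= /andP[u0 c0]] /eqP r0] := ap0.
apply: leq_trans c0; apply: sub_count => p' /andP[/andP[/eqP qp' /= /andP[u'
  _]] /eqP r'].
by rewrite u' andbT; apply/eqP/resP; rewrite ?qp' ?r0.
Qed.

Lemma class_eq p p' : (class p == class p') =
  (level p == level p') && (q (level p') p == q (level p') p').
Proof. by rewrite /class xpair_eqE; case: eqVneq => // ->. Qed.

Lemma count_class p : p \in P ->
  count (fun p' => class p' == class p) P <= #|F| * K.
Proof.
move=> /(count_unassigned (level p)); apply: leq_trans.
apply: sub_count => p'; rewrite class_eq => /andP[/eqP <- ->].
by rewrite unassigned_level.
Qed.

Lemma count_class_ge p : p \in P -> level p < N ->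
  K <= count (fun p' => class p' == class p) P.
Proof.
move=> pP lpN; have /= := level_lt_unassigned lpN.
rewrite unassigned_level /= -ltnNge => /ltnW; move/leq_trans; apply.
apply: sub_count => p' /andP[/eqP qp' u']; rewrite class_eq qp' eqxx andbT.
rewrite eqn_leq (level_cell qp') /=.
rewrite leqNgt; apply/negP => lt.
have l'N : level p' < N by apply: ltn_trans lpN.
have := level_lt_unassigned l'N.
by rewrite (unassigned_le lt u').
Qed.

(** Classes below level [N] are disjoint and hold at least [K] points each; the leftover classes at
    level [N] are at most [#|F|] by [topP]. *)
Lemma size_classes : size (undup (map class P)) * K <= size P + #|F| * K.
Proof.
rewrite -(count_predC (fun c => c.1 < N)) mulnDl leq_add //.
  apply: leq_trans (sum_count P class (undup_uniq (map class P))).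
  rewrite -sum1_count big_distrl /= big_mkcond /= big_seq_cond.
  rewrite [leqRHS]big_seq_cond; apply: leq_sum => c.
  rewrite andbT mem_undup => /mapP[p pP ->].
  by case: ifP => // lp; rewrite mul1n count_class_ge.
rewrite leq_mul2r; apply/orP; right.
rewrite -size_filter.
apply: (@leq_trans (size (undup (map (fun p => (N, q N p)) P)))).
  apply: uniq_leq_size; first exact/filter_uniq/undup_uniq.
  move=> c; rewrite mem_filter !mem_undup => /andP[/= cN /mapP[p pP ec]].
  apply/mapP; exists p => //; rewrite ec in cN *.
  by have /eqP <- : level p == N by rewrite eqn_leq level_le leqNgt.
apply: leq_trans (size_undup_map_factor (h := top) _) _.
  by move=> p p' pP p'P /topP ->.
exact/size_uniq_card/undup_uniq.
Qed.

End Cutting.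

Section Energy.
Local Open Scope nat_scope.

Variables (T : eqType) (op : T -> T -> T).

Definition rep (F G : seq T) x := \sum_(a <- F) \sum_(b <- G) (op a b == x :
  nat).

Lemma rep_le_size F G x : uniq G -> {in F, forall a, {in G &,
  injective (op a)}} ->
  rep F G x <= size F.
Proof.
move=> uG inj; rewrite /rep -sum1_size big_seq [leqRHS]big_seq.
apply: leq_sum => a aF; apply: sum_le1 => // b b' bG b'G /eqP h /eqP h'.
by apply: (inj a aF) => //; rewrite h h'.
Qed.

Lemma sum_rep F G (S : seq T) : uniq S ->
  \sum_(x <- S) rep F G x <= size F * size G.
Proof.
move=> uS; rewrite exchange_big /= -sum1_size big_distrl /=.
apply: leq_sum => a _; rewrite exchange_big /= mul1n -sum1_size.
by apply: leq_sum => b _; rewrite sum_eq_uniq //; case: (_ \in _).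
Qed.

Lemma rep_cat F1 F2 G x : rep (F1 ++ F2) G x = rep F1 G x + rep F2 G x.
Proof. by rewrite /rep big_cat. Qed.

Lemma rep_sub F G1 G2 x : uniq G1 -> {subset G1 <= G2} -> rep F G1 x <= rep F
  G2 x.
Proof. by move=> u1 s12; apply: leq_sum => a _; apply: sum_sub_uniq. Qed.

(** Incidences of the curve indexed by [(c, x)]: the parameter [a] runs along the curve, whose
    points are the [(op a c, b)] with [op (f a) b = x]. *)
Definition richness (f : T -> T) (R0 A P : seq T) c x :=
  \sum_(a <- A) \sum_(b <- R0) ((op a c \in P) && (op (f a) b == x) : nat).

End Energy.

(** * Shifted quaternary grids in the complex plane *)

Local Notation normc := ComplexField.Normc.normc.

Section Grid.

Variable R : realType.
Implicit Types (s x y : R) (z w : R[i]) (n : nat) (b : bool) (g : bool * bool).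

Lemma ler_normc_Re z : `|complex.Re z| <= normc z.
Proof. by have := normc_ge_Re z; rewrite normc_def lecR; case: z. Qed.

Lemma ler_normc_Im z : `|complex.Im z| <= normc z.
Proof.
by case: z => a b /=; rewrite -sqrtr_sqr ler_wsqrtr // lerDr sqr_ge0.
Qed.

Lemma normc_ge0 z : 0 <= normc z.
Proof. by case: z => a b; apply: sqrtr_ge0. Qed.

Lemma normc_le_ReIm z : normc z <= `|complex.Re z| + `|complex.Im z|.
Proof.
case: z => a b /=.
rewrite -[leRHS]ger0_norm ?addr_ge0 // -sqrtr_sqr ler_wsqrtr //.
rewrite sqrrD !real_normK ?num_real // addrAC lerDl mulrn_wge0 //.
by rewrite mulr_ge0.
Qed.

Lemma normc_distC z w : normc (z - w) = normc (w - z).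
Proof. by rewrite -normcN opprB. Qed.

Lemma ReB z w : complex.Re (z - w) = complex.Re z - complex.Re w.
Proof. by case: z w => ? ? [? ?]. Qed.

Lemma ImB z w : complex.Im (z - w) = complex.Im z - complex.Im w.
Proof. by case: z w => ? ? [? ?]. Qed.

Lemma normc_eq0 z : (normc z == 0) = (z == 0).
Proof.
apply/eqP/eqP => [/ComplexField.Normc.eq0_normc//|->].
exact: ComplexField.Normc.normc0.
Qed.

Lemma normc_gt0 z : (0 < normc z) = (z != 0).
Proof. by rewrite lt_def normc_eq0 normc_ge0 andbT. Qed.

Definition mod_tag k (m : int) : 'I_k.+1 := inord `|(m %% k.+1%:Z)%Z|%N.

Lemma mod_tag_inj k (m m' : int) :
  mod_tag k m = mod_tag k m' -> `|m - m'| <= k%:Z -> m = m'.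
Proof.
move=> /(congr1 val) /=; rewrite !inordK; last 2 first.
- by have := modz_ge0 m (isT : k.+1%:Z != 0); have := ltz_pmod m (isT : 0 <
  k.+1%:Z); lia.
- by have := modz_ge0 m' (isT : k.+1%:Z != 0);
  have := ltz_pmod m' (isT : 0 < k.+1%:Z); lia.
have := modz_ge0 m (isT : k.+1%:Z != 0).
have := modz_ge0 m' (isT : k.+1%:Z != 0).
have := divz_eq m k.+1; have := divz_eq m' k.+1.
move: (m %% _)%Z (m' %% _)%Z (m %/ _)%Z (m' %/ _)%Z => a a' q q' -> -> a0 a'0
  aa'.
have -> : a = a' by lia.
move=> H; suff -> : q = q' by [].
nia.
Qed.

Definition side s n : R := s * 4 ^+ n.

(** The shift is one third of the side at every level. From side S to side 4S the origin moves from
    S/3 to 4S/3, that is by one whole small cell; hence shifted grids are nested too. This is why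
    sides grow by a factor 4. *)
Definition cell1 s b n x : int := Num.floor (x / side s n - b%:R / 3).

Definition cell s g n z : int * int :=
  (cell1 s g.1 n (complex.Re z), cell1 s g.2 n (complex.Im z)).

Lemma side_gt0 s n : 0 < s -> 0 < side s n.
Proof. by move=> s0; rewrite mulr_gt0 // exprn_gt0. Qed.

Lemma sideS s n : side s n.+1 = 4 * side s n.
Proof. by rewrite /side exprS mulrCA. Qed.

Lemma floor_bounds x : (Num.floor x)%:~R <= x < (Num.floor x)%:~R + 1.
Proof. by have := floor_itv x; rewrite intrD. Qed.

Lemma floor_divB x y (e : int) : Num.floor x = Num.floor y ->
  Num.floor ((x - e%:~R) / 4) = Num.floor ((y - e%:~R) / 4).
Proof.
move=> xy; apply/esym/floor_def.
have := floor_bounds x; have := floor_bounds y; rewrite -xy.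
have := floor_bounds ((x - e%:~R) / 4).
move: (Num.floor x) (Num.floor _) => m M /andP[h1 h2] /andP[h3 h4] /andP[h5 h6].
have h7 : ((4 * M + e < m + 1)%R : bool).
  by rewrite -(ltr_int R) !intrD intrM; lra.
have h8 : ((m < 4 * M + 4 + e)%R : bool).
  by rewrite -(ltr_int R) !intrD intrM; lra.
have {}h7 : ((4 * M + e <= m)%R : bool) by lia.
have {}h8 : ((m + 1 <= 4 * M + 4 + e)%R : bool) by lia.
move: h7 h8; rewrite -!(ler_int R) !intrD !intrM => h7 h8.
by apply/andP; split; lra.
Qed.

Lemma shift_sideS s b n x : 0 < s ->
  x / side s n.+1 - b%:R / 3 = ((x / side s n - b%:R / 3) - (b : int)%:~R) / 4.
Proof.
move=> s0; rewrite sideS invfM; have := side_gt0 n s0.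
set S := side s n => S0; rewrite -pmulrn; field; lra.
Qed.

Lemma cell1S s b n x y : 0 < s ->
  cell1 s b n x = cell1 s b n y -> cell1 s b n.+1 x = cell1 s b n.+1 y.
Proof.
by move=> s0 xy; rewrite /cell1 !shift_sideS //; apply: floor_divB.
Qed.

Lemma cell1_res s b n x y : 0 < s ->
  cell1 s b n.+1 x = cell1 s b n.+1 y ->
  mod_tag 3 (cell1 s b n x) = mod_tag 3 (cell1 s b n y) ->
  cell1 s b n x = cell1 s b n y.
Proof.
move=> s0; rewrite /cell1 !shift_sideS // => e /mod_tag_inj; apply.
set X := x / _ - _ in e *; set Y := y / _ - _ in e *.
have := floor_bounds X; have := floor_bounds Y.
have := floor_bounds ((X - (b : int)%:~R) / 4).
have := floor_bounds ((Y - (b : int)%:~R) / 4).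
rewrite e.
move: (Num.floor _) (Num.floor X) (Num.floor Y) => M m m' /andP[h1 h2] /andP[h3
  h4] /andP[h5 h6] /andP[h7 h8].
have h9 : (m < 4 * M + b + 4)%R by rewrite -(ltr_int R) !intrD intrM; lra.
have h10 : (m' < 4 * M + b + 4)%R by rewrite -(ltr_int R) !intrD intrM; lra.
have h11 : (4 * M + b < m + 1)%R by rewrite -(ltr_int R) !intrD intrM; lra.
have h12 : (4 * M + b < m' + 1)%R by rewrite -(ltr_int R) !intrD intrM; lra.
by lia.
Qed.

Lemma cell1_close s b n x y : 0 < s ->
  cell1 s b n x = cell1 s b n y -> `|x - y| < side s n.
Proof.
move=> s0; rewrite /cell1 => e; have S0 := side_gt0 n s0.
have := floor_bounds (x / side s n - b%:R / 3).
have := floor_bounds (y / side s n - b%:R / 3); rewrite e.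
move=> /andP[h1 h2] /andP[h3 h4].
have : `|x / side s n - y / side s n| < 1.
  by rewrite ltr_norml; apply/andP; split; lra.
by rewrite -mulrBl normrM normfV [ `|side s n|]gtr0_norm // ltr_pdivrMr //
  mul1r.
Qed.

Lemma cell1_far s b n x y (c : nat) : 0 < s ->
  `|x - y| <= c%:R * side s n ->
  `|cell1 s b n x - cell1 s b n y| <= c.+1%:Z.
Proof.
move=> s0 xy; have S0 := side_gt0 n s0.
have : `|x / side s n - y / side s n| <= c%:R.
  by rewrite -mulrBl normrM normfV [ `|side s n|]gtr0_norm // ler_pdivrMr.
rewrite /cell1 ler_norml => /andP[h1 h2].
have := floor_bounds (x / side s n - b%:R / 3).
have := floor_bounds (y / side s n - b%:R / 3).
move: (Num.floor _) (Num.floor (x / _ - _)) => m m' /andP[h3 h4] /andP[h5 h6].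
have h9 : (m - m' < c%:Z + 1)%R.
  by rewrite -(ltr_int R) intrB intrD -pmulrn; lra.
have h10 : (m' - m < c%:Z + 1)%R.
  by rewrite -(ltr_int R) intrB intrD -pmulrn; lra.
by lia.
Qed.

Lemma cellS s g n z w : 0 < s ->
  cell s g n z = cell s g n w -> cell s g n.+1 z = cell s g n.+1 w.
Proof.
by move=> s0 [e1 e2]; rewrite /cell (cell1S s0 e1) (cell1S s0 e2).
Qed.

Lemma cell_le s g m n z w : 0 < s -> (m <= n)%N ->
  cell s g m z = cell s g m w -> cell s g n z = cell s g n w.
Proof.
move=> s0 /subnK <-; elim: (n - m)%N => //= k IHk /IHk; exact: cellS.
Qed.

Lemma cell_close s g n z w : 0 < s ->
  cell s g n z = cell s g n w -> normc (z - w) < 2 * side s n.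
Proof.
move=> s0 [/(cell1_close s0) e1 /(cell1_close s0) e2].
apply: le_lt_trans (normc_le_ReIm _) _; rewrite ReB ImB; lra.
Qed.

Lemma le_side s m n : 0 < s -> (side s m <= side s n) = (m <= n)%N.
Proof. by move=> s0; rewrite ler_pM2l // ler_eXn2l // ltr1n. Qed.

(** The interval has length at most a quarter of the side, while lines of the two grids are at least
    a third of the side apart: it cannot meet lines of both. *)
Lemma exists_shift s n x r : 0 < s -> 8 * r <= side s n ->
  exists b, forall y, `|y - x| <= r -> cell1 s b n y = cell1 s b n x.
Proof.
move=> s0; have S0 := side_gt0 n s0; set S := side s n in S0 * => rS.
pose X := x / S; pose m := Num.floor (X + 1 / 8).
have HY y : `|y - x| <= r -> X - 1 / 8 <= y / S <= X + 1 / 8.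
  move=> yx; rewrite -ler_distl -mulrBl normrM normfV [ `|S|]gtr0_norm //.
  rewrite ler_pdivrMr //. by lra.
have /andP[m1 m2] : m%:~R <= X + 1 / 8 < m%:~R + 1 := floor_bounds _.
suff [b [k Hk]] : exists b k, forall Y, X - 1 / 8 <= Y <= X + 1 / 8 ->
    Num.floor (Y - b%:R / 3) = k.
  exists b => y /HY HY'; rewrite /cell1 !Hk // /X; apply/andP; split; lra.
have [h|h] := leP m%:~R (X - 1 / 8).
  exists false, m => Y /andP[Y1 Y2]; apply: floor_def;
    rewrite mul0r subr0 intrD.
  by apply/andP; split; lra.
(* The unshifted line [m] falls within the interval, so the neighbouring shifted lines m - 2/3 and m
   + 1/3 fall outside it. *)
exists true, (m - 1) => Y /andP[Y1 Y2]; apply: floor_def; rewrite mulr1n.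
by rewrite subrK intrB; apply/andP; split; lra.
Qed.

(** The shifts are chosen at the finest admissible level and nesting carries the conclusion to all
    coarser ones. Thus the grid can be fixed without knowing the level of a class. *)
Lemma exists_grid s z r : 0 < s ->
  exists g, forall n, 8 * r <= side s n ->
    forall w, normc (w - z) <= r -> cell s g n w = cell s g n z.
Proof.
move=> s0.
have [[n0 n0P]|H] := pselect (exists n, 8 * r <= side s n); last first.
  by exists (true, true) => n ?; case: H; exists n.
case: (ex_minnP (ex_intro (fun n => 8 * r <= side s n) n0 n0P)) => {n0P}n0 n0P
  n0min.
have [b1 H1] := exists_shift (complex.Re z) s0 n0P.
have [b2 H2] := exists_shift (complex.Im z) s0 n0P.
exists (b1, b2) => n /n0min n0n w wz; apply: cell_le n0n _ => //.
rewrite /cell /= H1 ?H2 //.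
  by rewrite -ImB; apply: le_trans (ler_normc_Im _) wz.
by rewrite -ReB; apply: le_trans (ler_normc_Re _) wz.
Qed.

(** Sixteen residues suffice: sides within a factor 4^15 of each other are fewer than 15 levels
    apart, and points within 14 sides are at most 15 cells apart. *)
Definition cell_tag s g n z : 'I_16 * 'I_16 * 'I_16 :=
  (mod_tag 15 n, mod_tag 15 (cell s g n z).1, mod_tag 15 (cell s g n z).2).

Lemma cell_tag_inj s g m n z w : 0 < s ->
  side s m < 4 ^+ 15 * side s n -> side s n < 4 ^+ 15 * side s m ->
  normc (z - w) <= 7 * (side s m + side s n) -> cell_tag s g m z = cell_tag s g
    n w ->
  m = n /\ cell s g m z = cell s g m w.
Proof.
move=> s0 mn nm zw [tn t1 t2].
have lev k l : side s k < 4 ^+ 15 * side s l -> (k < l + 15)%N.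
  rewrite mulrCA ltr_pM2l // -exprD ltr_eXn2l ?ltr1n //.
  by rewrite addnC.
have {}mn := lev _ _ mn; have {}nm := lev _ _ nm.
have [] : (m%:Z = n%:Z) by apply: (mod_tag_inj tn); lia.
move=> emn; subst n; split=> //.
have {}zw : normc (z - w) <= 14 * side s m by lra.
congr pair.
  apply: (mod_tag_inj t1); apply: cell1_far => //.
  by rewrite -ReB; apply: le_trans (ler_normc_Re _) zw.
apply: (mod_tag_inj t2); apply: cell1_far => //.
by rewrite -ImB; apply: le_trans (ler_normc_Im _) zw.
Qed.

End Grid.

(** * Classes of bounded size in each shifted grid *)

Section GridClasses.

Variable R : realType.
Implicit Types (s x y : R) (z w p : R[i]) (n : nat) (g : bool * bool).

Definition grid_class s (lev : bool * bool -> R[i] -> nat) g p :=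
  (lev g p, cell s g (lev g p) p).

Lemma exists_side_ge s x : 0 < s -> exists n, x <= side s n.
Proof.
move=> s0; exists (Num.truncn (x / s)).+1.
have := truncnS_gt (x / s); set k := Num.truncn _ => h.
rewrite -ler_pdivrMl // mulrC; apply: ltW; apply: lt_le_trans h _.
by rewrite -natrX ler_nat ltnW // ltn_expl.
Qed.

Lemma exists_separation (P : seq R[i]) :
  exists2 s, 0 < s & {in P &, forall p p', p != p' -> 2 * s <= normc (p - p')}.
Proof.
elim: P => [|p P [s s0 IH]]; first by exists 1.
have [r r0 Hr] : exists2 r, 0 < r &
    {in P, forall p', p != p' -> 2 * r <= normc (p - p')}.
  elim: P {IH} => [|p' P [r r0 IHr]]; first by exists 1.
  have [<-|pp'] := eqVneq p p'.
    exists r => // w; rewrite inE => /orP[/eqP->|/IHr//]; by rewrite eqxx.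
  have d0 : 0 < normc (p - p') by rewrite normc_gt0 subr_eq0.
  exists (Num.min r (normc (p - p') / 2)); first by rewrite lt_min r0 divr_gt0.
  move=> w; rewrite inE => /orP[/eqP-> _|/IHr H /H {}H].
    by rewrite mulrC -ler_pdivlMr // ge_min lexx orbT.
  by apply: le_trans H; rewrite ler_pM2l // ge_min lexx.
exists (Num.min s r); first by rewrite lt_min s0.
have Hs a b : Num.min a b <= a :> R by rewrite ge_min lexx.
have Hs' a b : Num.min a b <= b :> R by rewrite ge_min lexx orbT.
move=> a b; rewrite !inE => /orP[/eqP->|aP] /orP[/eqP->|bP].
- by rewrite eqxx.
- by move/(Hr _ bP); apply: le_trans; rewrite ler_pM2l.
- rewrite eq_sym normc_distC => /(Hr _ aP); apply: le_trans;
  by rewrite ler_pM2l.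
- by move/(IH _ _ aP bP); apply: le_trans; rewrite ler_pM2l.
Qed.

Lemma cell1_top s b n x : 0 < s -> 4 * `|x| <= side s n ->
  -1 <= cell1 s b n x <= 0.
Proof.
move=> s0 h; have S0 := side_gt0 n s0.
have : `|x / side s n| <= 1 / 4.
  rewrite normrM normfV [ `|side s n|]gtr0_norm // ler_pdivrMr //; lra.
rewrite ler_norml => /andP[h1 h2].
rewrite floor_ge_int -ltzD1 floor_lt_int.
case: b; rewrite ?mulr1n ?mul0r ?subr0; apply/andP; split; rewrite ?intrD; lra.
Qed.

(** The separation of [P] makes the finest cells singletons, and at a level [N] that is large enough
    all cell coordinates are -1 or 0. A cell has 4 by 4 children, whence the constant 16. *)
Lemma exists_grid_classes (P : seq R[i]) : uniq P ->
  exists2 s, 0 < s & forall K, (0 < K)%N ->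
  exists lev : bool * bool -> R[i] -> nat, forall g,
    [/\ forall p p', cell s g (lev g p) p' = cell s g (lev g p) p ->
          (lev g p' <= lev g p)%N,
        {in P, forall p, (count (fun p' => grid_class s lev g p' ==
           grid_class s lev g p) P <= 16 * K)%N} &
        (size (undup (map (grid_class s lev g) P)) * K <= size P + 16 * K)%N].
Proof.
move=> uP; have [s s0 sep] := exists_separation P.
exists s => // K K0.
have [N HN] : exists N, {in P, forall p, 4 * normc p <= side s N}.
  elim: (P) => [|p P' [N IH]]; first by exists 0%N.
  have [n Hn] := exists_side_ge (4 * normc p) s0.
  exists (maxn N n) => q; rewrite inE => /orP[/eqP->|/IH H].
    by apply: le_trans Hn _; rewrite le_side // leq_maxr.
  by apply: le_trans H _; rewrite le_side // leq_maxl.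
pose top g p := (mod_tag 3 (cell s g N p).1, mod_tag 3 (cell s g N p).2).
pose res g n p := (mod_tag 3 (cell s g n p).1, mod_tag 3 (cell s g n p).2).
have card16 : #|{: 'I_4 * 'I_4}| = 16%N by rewrite card_prod !card_ord.
exists (fun g => level P (cell s g) K N) => g.
have q0 : {in P &, injective (cell s g 0)}.
  move=> p p' pP p'P /(cell_close s0) h.
  have [//|ne] := eqVneq p p'; have := sep _ _ pP p'P ne.
  by move: h; rewrite /side expr0 mulr1 => h1 h2; exfalso; lra.
have resP n p p' : cell s g n.+1 p = cell s g n.+1 p' -> res g n p = res g n p'
  ->
    cell s g n p = cell s g n p'.
  by move=> [e1 e2] [t1 t2]; congr pair; apply: cell1_res.
have topP : {in P &, forall p p', top g p = top g p' -> cell s g N p = cell s g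
  N p'}.
  move=> p p' /HN pN /HN p'N [t1 t2].
  have HRe w : 4 * normc w <= side s N -> 4 * `|complex.Re w| <= side s N.
    by apply: le_trans; rewrite ler_pM2l // ler_normc_Re.
  have HIm w : 4 * normc w <= side s N -> 4 * `|complex.Im w| <= side s N.
    by apply: le_trans; rewrite ler_pM2l // ler_normc_Im.
  congr pair.
    apply: (mod_tag_inj t1) => /=.
    have := cell1_top g.1 s0 (HRe _ pN); have := cell1_top g.1 s0 (HRe _ p'N);
      lia.
  apply: (mod_tag_inj t2) => /=.
  have := cell1_top g.2 s0 (HIm _ pN); have := cell1_top g.2 s0 (HIm _ p'N);
    lia.
split.
- by move=> p p'; apply: level_cell.
- move=> p pP; rewrite -card16.
  exact: (count_class N uP K0 q0 resP).
- rewrite -card16; exact: (size_classes K topP).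
Qed.

End GridClasses.

(** * Joint classes on a curve *)

Lemma pow4_15 (R : realType) : 1024 * 1024 <= 4 ^+ 15 :> R.
Proof.
have e : 4 ^+ 5 = 1024 :> R by rewrite !exprS expr0; ring.
have -> : 4 ^+ 15 = 4 ^+ 5 * 4 ^+ 5 * 4 ^+ 5 :> R by rewrite -!exprD.
by rewrite e; lra.
Qed.

(** * Certificates: when the class of one coordinate determines the other *)

Section Certificates.

Variables (R : realType) (I : Type) (V : I -> Prop) (s t : R).
(* [xi v] and [eta v] are the coordinates of a point of the curve, near which
   [eta] as a function of [xi] scales distances by about [l1 v / l2 v]. *)
Variables (xi eta : I -> R[i]) (l1 l2 : I -> R).
Variables (la lb : bool * bool -> R[i] -> nat).
Implicit Types (g h : bool * bool) (u v : I) (k : bool).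

Hypothesis s_gt0 : 0 < s.
Hypothesis t_gt0 : 0 < t.
Hypothesis la_cell : forall g p p',
  cell s g (la g p) p' = cell s g (la g p) p -> (la g p' <= la g p)%N.
Hypothesis l1_gt0 : forall v, V v -> 0 < l1 v.
Hypothesis l2_gt0 : forall v, V v -> 0 < l2 v.

Let a g v := side s (la g (xi v)).
Let b h v := side t (lb h (eta v)).
Let sameA g u v := grid_class s la g (xi u) = grid_class s la g (xi v).
Let sameB h u v := grid_class t lb h (eta u) = grid_class t lb h (eta v).

Lemma grid_class_eq g p p' :
  cell s g (la g p) p' = cell s g (la g p) p ->
  cell s g (la g p') p = cell s g (la g p') p' ->
  grid_class s la g p = grid_class s la g p'.
Proof.
move=> e1 e2; have e : la g p = la g p'.
  by apply/eqP; rewrite eqn_leq (la_cell e1) (la_cell e2).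
by rewrite /grid_class -e e1.
Qed.

Lemma sameB_b h u v : sameB h u v -> b h u = b h v.
Proof. by case=> e _ _; rewrite /b e. Qed.

Lemma sameB_close h u v : sameB h u v -> normc (eta u - eta v) < 2 * b h u.
Proof.
case=> e e1 e2; apply: (@cell_close _ t h (lb h (eta u))) => //.
by rewrite {2}e /cell e1 e2.
Qed.

(** Here [r] is a length multiplied by a weight, so that both coordinates of the curve near [v] are
    measured in the same unit. *)
Definition locally_similar v r := forall u, V u ->
  l2 v * normc (eta u - eta v) <= 2 * r ->
  [/\ l1 v * normc (xi u - xi v) <= 4 * r, l1 u <= 2 * l1 v, l1 v <= 2 * l1 u
    & l2 u <= 2 * l2 v].

(** In normalised length the class cell of [eta v] is the smaller one, and no cell of the grid [g]
    that is large enough cuts the part of the curve above it. The bit [k] tells whether the class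
    cell of [xi v] is itself that large; if not, the two cells have comparable sizes. *)
Definition local_cert k g h v :=
  let r := l2 v * b h v in
  [/\ locally_similar v r, r <= l1 v * a g v,
    forall n, 8 * (4 * r / l1 v) <= side s n ->
      forall w, normc (w - xi v) <= 4 * r / l1 v ->
        cell s g n w = cell s g n (xi v)
  & (32 * r <= l1 v * a g v) = k].

Lemma exists_local_cert h v : locally_similar v (l2 v * b h v) ->
  (forall g, l2 v * b h v <= l1 v * a g v) -> exists k g, local_cert k g h v.
Proof.
move=> loc min.
have [g Hg] := exists_grid (xi v) (4 * (l2 v * b h v) / l1 v) s_gt0.
by exists (32 * (l2 v * b h v) <= l1 v * a g v), g.
Qed.

(** If [k] holds, each of [xi u] and [xi v] lies in the class cell of the other, which is the
    situation of [grid_class_eq]. Otherwise the sides [a g u] and [a g v] agree up to a factor 128,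
    and the residues in the tag recover level and cell. *)
Lemma local_cert_same k g h u v : V u -> V v ->
  local_cert k g h u -> local_cert k g h v ->
  cell_tag s g (la g (xi u)) (xi u) = cell_tag s g (la g (xi v)) (xi v) ->
  sameB h u v -> sameA g u v.
Proof.
move=> Vu Vv [locu minu goodu ku] [locv minv goodv kv] tag sB.
have l1u := l1_gt0 Vu; have l1v := l1_gt0 Vv.
have l2u := l2_gt0 Vu; have l2v := l2_gt0 Vv.
have bE := sameB_b sB; have b0 : 0 < b h u by apply: side_gt0.
have cl := sameB_close sB.
have [] := locu v Vv.
  by rewrite normc_distC mulrCA ler_pM2l // ltW.
rewrite normc_distC => d1 r1 r2 r3.
have [] := locv u Vu.
  by rewrite mulrCA ler_pM2l // -bE ltW.
move=> d2 _ _ r4.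
have au0 : 0 < a g u by apply: side_gt0.
have av0 : 0 < a g v by apply: side_gt0.
case: k ku kv => ku kv.
  apply: grid_class_eq.
    apply: goodu; last by rewrite normc_distC ler_pdivlMr // mulrC.
    by rewrite mulrA ler_pdivrMr // mulrA [leRHS]mulrC; apply: le_trans ku; lra.
  apply: goodv; last by rewrite ler_pdivlMr // mulrC.
  by rewrite mulrA ler_pdivrMr // mulrA [leRHS]mulrC; apply: le_trans kv; lra.
move/negbT: ku; move/negbT: kv; rewrite -!ltNge => kv ku.
have ratio (w w' : I) : 0 < l1 w -> 0 < a g w -> b h w = b h w' -> 0 < b h w' ->
  l1 w * a g w < 32 * (l2 w * b h w) -> l2 w <= 2 * l2 w' ->
  l2 w' * b h w' <= l1 w' * a g w' -> l1 w' <= 2 * l1 w -> 0 < a g w' ->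
  a g w < 4 ^+ 15 * a g w'.
  move=> p1 p2 e p3 q1 q2 q3 q4 p4; rewrite -(ltr_pM2l p1).
  have h1 : l2 w * b h w <= 2 * l2 w' * b h w' by rewrite e ler_pM2r.
  have h2 : l1 w' * a g w' <= 2 * l1 w * a g w' by rewrite ler_pM2r.
  have h3 : 0 < l1 w * a g w' by rewrite mulr_gt0.
  have -> : l1 w * (4 ^+ 15 * a g w') = 4 ^+ 15 * (l1 w * a g w') by ring.
  apply: (@lt_le_trans _ _ (128 * (l1 w * a g w'))); first by lra.
  by rewrite ler_pM2r //; have := pow4_15 R; lra.
have [] := @cell_tag_inj _ s g (la g (xi u)) (la g (xi v)) (xi u) (xi v) => //.
- by apply: (ratio u v) => //; rewrite -bE.
- exact: (ratio v u).
- rewrite -/(a g u) -/(a g v).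
  have : l1 u * normc (xi u - xi v) <= l1 u * (4 * a g u) by lra.
  by rewrite ler_pM2l //; lra.
- by move=> e1 e2; rewrite /sameA /grid_class -e1 e2.
Qed.

Variable xi0 : R[i].
Hypothesis l12 : forall v, V v -> l1 v * l2 v = 1.
Hypothesis xi_dist : forall v, V v -> normc (xi v - xi0) <= l2 v.

(** This and the next certificate serve cells comparable to, or larger than, the distance to the
    centre of an inversion curve, where local similarity is lost. Here both normalised sides lie in
    a bounded range, so residues suffice. *)
Definition wide_cert g h v :=
  [/\ 1 / 4 <= l1 v * a g v, l1 v * a g v < 256,
      1 / 4 <= l2 v * b h v & l2 v * b h v < 256].

Definition big_grid g v := forall n, 8 * l2 v <= side s n ->
  forall w, normc (w - xi0) <= l2 v -> cell s g n w = cell s g n xi0.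

(** A common class for [eta] forces the values of [l2] to agree up to a factor 32. Since 256 = 8 *
    32, the class cell of either point then holds the discs around [xi0] reaching both [xi u] and
    [xi v]. *)
Definition tall_cert g h v :=
  [/\ 1 / 4 <= l2 v * b h v, l2 v * b h v < 8, 256 <= l1 v * a g v
    & big_grid g v].

Lemma wide_cert_same g h u v : V u -> V v ->
  wide_cert g h u -> wide_cert g h v ->
  cell_tag s g (la g (xi u)) (xi u) = cell_tag s g (la g (xi v)) (xi v) ->
  sameB h u v -> sameA g u v.
Proof.
move=> Vu Vv [u1 u2 u3 u4] [v1 v2 v3 v4] tag sB.
have l1u := l1_gt0 Vu; have l1v := l1_gt0 Vv.
have l2u := l2_gt0 Vu; have l2v := l2_gt0 Vv.
have bE := sameB_b sB; have b0 : 0 < b h u by apply: side_gt0.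
have au0 : 0 < a g u by apply: side_gt0.
have av0 : 0 < a g v by apply: side_gt0.
have aE (w : I) : V w -> a g w = l2 w * (l1 w * a g w).
  by move=> Vw; rewrite mulrA [_ * l1 _]mulrC l12 // mul1r.
have ratio (w w' : I) : V w -> V w' -> b h w = b h w' ->
  l2 w * b h w < 256 -> 1 / 4 <= l2 w' * b h w' ->
  l1 w * a g w < 256 -> 1 / 4 <= l1 w' * a g w' -> a g w < 4 ^+ 15 * a g w'.
  move=> Vw Vw' e q1 q2 q3 q4.
  have p1 := l2_gt0 Vw; have p2 := l2_gt0 Vw'.
  have q5 : l2 w < 1024 * l2 w'.
    have p3 : 0 < b h w' by apply: side_gt0.
    rewrite -(ltr_pM2r p3) -e; rewrite e in q1 *; lra.
  rewrite (aE w) // (aE w') //.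
  apply: (@lt_trans _ _ (l2 w * 256)); first by rewrite ltr_pM2l.
  have h1 : l2 w' * (1 / 4) <= l2 w' * (l1 w' * a g w') by rewrite ler_pM2l.
  have h2 : 0 <= l2 w' * (l1 w' * a g w') by apply: le_trans h1; lra.
  have := ler_wpM2r h2 (pow4_15 R).
  by move: (4 ^+ 15 : R) (l2 w' * (l1 w' * _)) h1 h2 => X Y h1 h2; lra.
have [] := @cell_tag_inj _ s g (la g (xi u)) (la g (xi v)) (xi u) (xi v) => //.
- exact: (ratio u v).
- by apply: (ratio v u).
- rewrite -/(a g u) -/(a g v) (aE u) // (aE v) //.
  have h1 : l2 u * (1 / 4) <= l2 u * (l1 u * a g u) by rewrite ler_pM2l.
  have h2 : l2 v * (1 / 4) <= l2 v * (l1 v * a g v) by rewrite ler_pM2l.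
  have -> : xi u - xi v = (xi u - xi0) - (xi v - xi0) by ring.
  apply: le_trans (le_normcD _ _) _; rewrite normcN.
  have := xi_dist Vu; have := xi_dist Vv; lra.
- by move=> e1 e2; rewrite /sameA /grid_class -e1 e2.
Qed.

Lemma tall_cert_same g h u v : V u -> V v ->
  tall_cert g h u -> tall_cert g h v -> sameB h u v -> sameA g u v.
Proof.
move=> Vu Vv [u1 u2 u3 u4] [v1 v2 v3 v4] sB.
have bE := sameB_b sB; have b0 : 0 < b h u by apply: side_gt0.
have aE (w : I) : V w -> a g w = l2 w * (l1 w * a g w).
  by move=> Vw; rewrite mulrA [_ * l1 _]mulrC l12 // mul1r.
have key (w w' : I) : V w -> V w' -> b h w = b h w' ->
    1 / 4 <= l2 w * b h w -> l2 w' * b h w' < 8 ->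
    256 <= l1 w * a g w -> 8 * l2 w' <= a g w.
  move=> Vw Vw' e q1 q2 q3; rewrite aE //.
  have p1 := l2_gt0 Vw; have p2 := l2_gt0 Vw'.
  have q5 : l2 w' < 32 * l2 w.
    have p3 : 0 < b h w' by apply: side_gt0.
    rewrite -(ltr_pM2r p3); rewrite e in q1 *; lra.
  have h1 : l2 w * 256 <= l2 w * (l1 w * a g w) by rewrite ler_pM2l.
  by lra.
have self (w : I) : V w -> 256 <= l1 w * a g w -> 8 * l2 w <= a g w.
  move=> Vw h1; rewrite aE // [leLHS]mulrC.
  by rewrite ler_pM2l ?l2_gt0 //; lra.
apply: grid_class_eq.
  rewrite (v4 (la g (xi u))); last 2 first.
  - exact: (key u v).
  - exact: xi_dist.
  by rewrite u4 //; [apply: self|apply: xi_dist].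
rewrite (u4 (la g (xi v))); last 2 first.
- exact: (key v u).
- exact: xi_dist.
by rewrite v4 //; [apply: self|apply: xi_dist].
Qed.

End Certificates.

Definition cert_kind : finType := option (bool * bool).
Definition tag_type : finType := ('I_16 * 'I_16 * 'I_16)%type.
Definition grid_id : finType := (bool * bool)%type.
(** Its cardinality is the constant lost per class. A label records which coordinate determines the
    other, one grid for each factor, the kind of certificate, and the residues of both cells. *)
Definition label_type : finType :=
  (bool * grid_id * grid_id * (cert_kind * tag_type * tag_type))%type.

Lemma exists_argmin (R : realType) (T : finType) (x0 : T) (F : T -> R) :
  exists i, forall j, F i <= F j.
Proof.
by case: (@arg_minP _ _ _ x0 xpredT F isT) => i _ H; exists i => j; apply: H.
Qed.

(** * Finite labels on the points of a curve *)

Section Labels.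

Variables (R : realType) (I : Type) (V : I -> Prop) (s t : R).
Variables (xi eta : I -> R[i]) (l1 l2 : I -> R).
Variables (la lb : bool * bool -> R[i] -> nat).
Implicit Types (g h : bool * bool) (u v : I) (k sd : bool).

Hypothesis s_gt0 : 0 < s.
Hypothesis t_gt0 : 0 < t.
Hypothesis la_cell : forall g p p',
  cell s g (la g p) p' = cell s g (la g p) p -> (la g p' <= la g p)%N.
Hypothesis lb_cell : forall g p p',
  cell t g (lb g p) p' = cell t g (lb g p) p -> (lb g p' <= lb g p)%N.
Hypothesis l1_gt0 : forall v, V v -> 0 < l1 v.
Hypothesis l2_gt0 : forall v, V v -> 0 < l2 v.

Let a g v := side s (la g (xi v)).
Let b h v := side t (lb h (eta v)).
Let sameA g u v := grid_class s la g (xi u) = grid_class s la g (xi v).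
Let sameB h u v := grid_class t lb h (eta u) = grid_class t lb h (eta v).

Variables (xi0 eta0 : R[i]).

Definition global_inversion :=
  [/\ forall v, V v -> l1 v * l2 v = 1,
      forall v, V v -> normc (xi v - xi0) <= l2 v
    & forall v, V v -> normc (eta v - eta0) <= l1 v].

(** Both cells are large enough to contain the corresponding coordinate of the centre, so each class
    is known from its level alone. *)
Definition stair_cert g h v :=
  [/\ big_grid s l2 xi0 g v, big_grid t l1 eta0 h v,
      8 <= l1 v * a g v & 8 <= l2 v * b h v].

Definition lowest g h v := forall u, V u -> stair_cert g h u ->
  lb h (eta u) = lb h (eta v) -> (la g (xi v) <= la g (xi u))%N.

Definition determined sd g h u v : Prop :=
  (if sd then sameA g u v else sameB h u v) -> sameA g u v /\ sameB h u v.

Section Stairs.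

Hypothesis Hinv : global_inversion.

Lemma stair_cellA g h v : V v -> stair_cert g h v ->
  forall w, normc (w - xi0) <= l2 v ->
    cell s g (la g (xi v)) w = cell s g (la g (xi v)) xi0.
Proof.
case: Hinv => l12 _ _ Vv [H _ h8 _]; apply: H; rewrite -/(a g v).
rewrite -(ler_pM2l (l1_gt0 Vv)) mulrCA l12 //; lra.
Qed.

Lemma stair_cellB g h v : V v -> stair_cert g h v ->
  forall w, normc (w - eta0) <= l1 v ->
    cell t h (lb h (eta v)) w = cell t h (lb h (eta v)) eta0.
Proof.
case: Hinv => l12 _ _ Vv [_ H _ h8]; apply: H; rewrite -/(b h v).
rewrite -(ler_pM2l (l2_gt0 Vv)) mulrCA [l2 v * l1 v]mulrC l12 //; lra.
Qed.

Lemma stair_mono g h u v : V u -> V v -> stair_cert g h u -> stair_cert g h v ->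
  l2 u <= l2 v ->
  (la g (xi u) <= la g (xi v))%N /\ (lb h (eta v) <= lb h (eta u))%N.
Proof.
case: (Hinv) => l12 dA dB Vu Vv su sv uv; split.
  apply: la_cell; rewrite (stair_cellA Vv sv) ?(stair_cellA Vv sv) ?dA //.
  exact: le_trans (dA _ Vu) uv.
apply: lb_cell; rewrite (stair_cellB Vu su) ?(stair_cellB Vu su) ?dB //.
apply: le_trans (dB _ Vv) _.
have l2v := l2_gt0 Vv; rewrite -(ler_pM2r l2v) l12 //.
by rewrite -(l12 _ Vu) ler_pM2l // l1_gt0.
Qed.

Lemma stair_sameA g h u v : V u -> V v -> stair_cert g h u -> stair_cert g h v
  ->
  la g (xi u) = la g (xi v) -> sameA g u v.
Proof.
case: (Hinv) => l12 dA dB Vu Vv su sv e; rewrite /sameA /grid_class.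
by rewrite (stair_cellA Vu su) ?dA // (stair_cellA Vv sv) ?dA // e.
Qed.

Lemma stair_sameB g h u v : V u -> V v -> stair_cert g h u -> stair_cert g h v
  ->
  lb h (eta u) = lb h (eta v) -> sameB h u v.
Proof.
case: (Hinv) => l12 dA dB Vu Vv su sv e; rewrite /sameB /grid_class.
by rewrite (stair_cellB Vu su) ?dB // (stair_cellB Vv sv) ?dB // e.
Qed.

(* Along the pairs (level of [xi v], level of [eta v]) one coordinate increases
   while the other decreases; such a pair is either the lowest in its row, and
   then is known from its row, or else is known from its column. *)
Lemma stair_low g h u v : V u -> V v -> stair_cert g h u -> stair_cert g h v ->
  lowest g h u -> lowest g h v -> sameB h u v -> sameA g u v.
Proof.
move=> Vu Vv su sv lu lv sB; apply: (stair_sameA Vu Vv su sv).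
have e : lb h (eta u) = lb h (eta v) by case: sB.
by apply/eqP; rewrite eqn_leq lu // lv.
Qed.

Lemma stair_not_low g h u v : V u -> V v -> stair_cert g h u ->
  stair_cert g h v ->
  ~ lowest g h u -> ~ lowest g h v -> sameA g u v -> sameB h u v.
Proof.
move=> Vu Vv su sv lu lv sA; apply: (stair_sameB Vu Vv su sv).
have key u1 u2 : V u1 -> V u2 -> stair_cert g h u1 -> stair_cert g h u2 ->
    ~ lowest g h u2 -> la g (xi u1) = la g (xi u2) ->
    (lb h (eta u2) < lb h (eta u1))%N -> False.
  move=> V1 V2 s1 s2 low e lt; apply: low => w Vw sw ew.
  rewrite leqNgt; apply/negP => lt'.
  have [h1|/ltW h1] := leP (l2 u1) (l2 w).
    by have [h2 _] := stair_mono V1 Vw s1 sw h1; rewrite leqNgt e lt' in h2.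
  by have [_ h2] := stair_mono Vw V1 sw s1 h1; rewrite leqNgt ew lt in h2.
have e : la g (xi u) = la g (xi v) by case: sA.
apply/eqP; rewrite eqn_leq; apply/andP; split; rewrite leqNgt; apply/negP.
  exact: (key u v Vu Vv su sv lv e).
exact: (key v u Vv Vu sv su lu (esym e)).
Qed.

End Stairs.

Definition cert (kd : cert_kind) sd g h v : Prop :=
  match kd with
  | Some (false, k) =>
      if sd then local_cert V t s eta xi l2 l1 lb la k h g v
      else local_cert V s t xi eta l1 l2 la lb k g h v
  | Some (true, false) =>
      global_inversion /\ wide_cert s t xi eta l1 l2 la lb g h v
  | Some (true, true) =>
      global_inversion /\
      (if sd then tall_cert t s eta xi l2 l1 lb la eta0 h g v
       else tall_cert s t xi eta l1 l2 la lb xi0 g h v)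
  | None => [/\ global_inversion, stair_cert g h v
               & if sd then ~ lowest g h v else lowest g h v]
  end.

Lemma cert_determined kd sd g h u v : V u -> V v ->
  cert kd sd g h u -> cert kd sd g h v ->
  cell_tag s g (la g (xi u)) (xi u) = cell_tag s g (la g (xi v)) (xi v) ->
  cell_tag t h (lb h (eta u)) (eta u) = cell_tag t h (lb h (eta v)) (eta v) ->
  determined sd g h u v.
Proof.
move=> Vu Vv cu cv ta tb.
suff key : (if sd then sameA g u v -> sameB h u v else sameB h u v -> sameA g u
  v).
  by case: sd key {cu cv} => H e; split=> //; apply: H.
case: kd cu cv => [[[] k]|]; first 1 last.
- case: sd => cu cv; first exact: (local_cert_same t_gt0 s_gt0 lb_cell l2_gt0
  l1_gt0 Vu Vv cu cv).
  exact: (local_cert_same s_gt0 t_gt0 la_cell l1_gt0 l2_gt0 Vu Vv cu cv).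
- by case: sd => -[Hi su lu] [_ sv lv]; [apply: stair_not_low|apply: stair_low].
have gi_swap : global_inversion -> [/\ forall v, V v -> l2 v * l1 v = 1,
    forall v, V v -> normc (eta v - eta0) <= l1 v
    & forall v, V v -> normc (xi v - xi0) <= l2 v].
  by case=> h1 h2 h3; split=> // w Vw; rewrite mulrC h1.
case: k => -[Hi cu] [_ cv].
  case: (Hi) => l12 dA dB; case: (gi_swap Hi) => l21 _ _.
  case: sd cu cv => cu cv.
    exact: (tall_cert_same s_gt0 lb_cell l1_gt0 l21 dB Vu Vv cu cv).
  exact: (tall_cert_same t_gt0 la_cell l2_gt0 l12 dA Vu Vv cu cv).
case: (Hi) => l12 dA dB; case: (gi_swap Hi) => l21 _ _.
case: sd.
  have sw w : wide_cert s t xi eta l1 l2 la lb g h w ->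
      wide_cert t s eta xi l2 l1 lb la h g w by case=> h1 h2 h3 h4; split.
  exact: (wide_cert_same t_gt0 s_gt0 l2_gt0 l1_gt0 l21 dB Vu Vv (sw _ cu) (sw _
    cv)).
exact: (wide_cert_same s_gt0 t_gt0 l1_gt0 l2_gt0 l12 dA Vu Vv cu cv).
Qed.

Hypothesis loc : forall v r, V v -> r < 1 / 4 \/ ~ global_inversion ->
  locally_similar V xi eta l1 l2 v r /\ locally_similar V eta xi l2 l1 v r.

(** The smallest normalised side, over both coordinates and all grids, decides. If it is below 1/4,
    or if there is no inversion, [loc] applies at that scale. Otherwise all normalised sides are at
    least 1/4, and the thresholds 8 and 256 separate the remaining kinds. *)
Lemma exists_cert v : V v -> exists kd sd g h, cert kd sd g h v.
Proof.
move=> Vv.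
pose F (x : bool * grid_id) :=
  if x.1 then l1 v * a x.2 v else l2 v * b x.2 v.
have [[sd g] Hmin] := exists_argmin (true, (true, true)) F.
have [lo|] := pselect (F (sd, g) < 1 / 4 \/ ~ global_inversion).
  have [locB locA] := loc Vv lo.
  case: sd Hmin lo locB locA => Hmin lo locB locA.
    have [k [h Hk]] := exists_local_cert t_gt0 locA (fun h => Hmin (false, h)).
    by exists (Some (false, k)), true, g, h.
  have [k [h Hk]] := exists_local_cert s_gt0 locB (fun h => Hmin (true, h)).
  by exists (Some (false, k)), false, h, g.
move=> /not_orP[/negP + /contrapT Hi]; rewrite -leNgt => H4.
have HA g' : 1 / 4 <= l1 v * a g' v by apply: le_trans H4 (Hmin (true, g')).
have HB g' : 1 / 4 <= l2 v * b g' v by apply: le_trans H4 (Hmin (false, g')).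
have [gA HgA] := exists_grid xi0 (l2 v) s_gt0.
have [gB HgB] := exists_grid eta0 (l1 v) t_gt0.
have [x8|x8] := ltP (l1 v * a gA v) 8.
  have [y|y] := ltP (l2 v * b gB v) 256.
    exists (Some (true, false)), true, gA, gB; split=> //.
    by have := HA gA; have := HB gB; move: x8 y; rewrite /a /b; split=> //; lra.
  exists (Some (true, true)), true, gA, gB; split=> //.
  by split; [exact: HA|exact: x8|exact: y|exact: HgB].
have [y8|y8] := ltP (l2 v * b gB v) 8.
  have [x|x] := ltP (l1 v * a gA v) 256.
    exists (Some (true, false)), true, gA, gB; split=> //.
    by have := HA gA; have := HB gB; move: y8 x; rewrite /a /b; split=> //; lra.
  exists (Some (true, true)), false, gA, gB; split=> //.
  by split; [exact: HB|exact: y8|exact: x|exact: HgA].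
have [lo|lo] := pselect (lowest gA gB v).
  by exists None, false, gA, gB; split.
by exists None, true, gA, gB; split.
Qed.

Theorem exists_labels : exists lab : I -> label_type,
  forall sd g h m u v, V u -> V v -> lab u = (sd, g, h, m) ->
    lab v = (sd, g, h, m) -> determined sd g h u v.
Proof.
have /choice[f Hf] : forall v, exists x : cert_kind * bool * grid_id * grid_id,
    V v -> cert x.1.1.1 x.1.1.2 x.1.2 x.2 v.
  move=> v; have [Vv|nV] := pselect (V v); last by exists (None, true, (true,
    true), (true, true)).
  by have [kd [sd [g [h H]]]] := exists_cert Vv; exists (kd, sd, g, h).
exists (fun v => let: (kd, sd, g, h) := f v in
  (sd, g, h, (kd, cell_tag s g (la g (xi v)) (xi v),
                  cell_tag t h (lb h (eta v)) (eta v)))).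
move=> sd g h m u v Vu Vv.
have := Hf u Vu; have := Hf v Vv.
case: (f u) (f v) => [[[kd sd1] g1] h1] [[[kd' sd2] g2] h2] /= cv cu.
move=> [e1 e2 e3 <-] [e4 e5 e6]; subst sd1 g1 h1 sd2 g2 h2.
move=> ek e1 e2 e3 e4 e5 e6; subst kd'.
by apply: (cert_determined Vu Vv cu cv); rewrite /cell_tag ?e1 ?e2 ?e3 ?e4 ?e5
  ?e6.
Qed.

End Labels.

Section JointClasses.

Variable R : realType.
Implicit Types (V P : seq R[i]) (xi eta : R[i] -> R[i]).

Definition affine_curve V xi eta := exists2 l : R, 0 < l &
  {in V &, forall u v, normc (eta u - eta v) = l * normc (xi u - xi v)}.

Definition inversion_curve V xi eta := exists c x : R[i],
  {in V, forall v, [/\ v != 0, xi v = v + c & eta v = v^-1 + x]}.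

(** The quantity [normc v * normc (u^-1 - v^-1)] is [normc (u - v) / normc u]. Being less than 1/2,
    it keeps [u] and [v] within half of [normc u], so their moduli are comparable. *)
Lemma inversion_similar (u v : R[i]) (r : R) : u != 0 -> v != 0 -> r < 1 / 4 ->
  normc v * normc (u^-1 - v^-1) <= 2 * r ->
  [/\ (normc v)^-1 * normc (u - v) <= 4 * r, normc v <= 2 * normc u
    & normc u <= 2 * normc v].
Proof.
move=> u0 v0 r4; have U := u0; have W := v0.
rewrite -normc_gt0 in U; rewrite -normc_gt0 in W.
have -> : u^-1 - v^-1 = (v - u) / (u * v).
  by field; rewrite u0 v0.
rewrite !ComplexField.Normc.normcM ComplexField.Normc.normcV.
rewrite ComplexField.Normc.normcM invfM mulrCA [_^-1 / _]mulrC mulVKf ?gt_eqF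
  //.
rewrite ler_pdivrMr // normc_distC => h.
have r0 : 0 <= 2 * r.
  by rewrite -(pmulr_lge0 _ U); apply: le_trans h; apply: normc_ge0.
have h1 : 2 * r * normc u <= 1 / 2 * normc u by rewrite ler_pM2r //; lra.
have uv : normc u <= normc (u - v) + normc v.
  by rewrite -{1}(subrK v u); apply: le_normcD.
have vu : normc v <= normc (u - v) + normc u.
  by rewrite normc_distC -{1}(subrK u v); apply: le_normcD.
have h2 : normc u <= 2 * normc v by lra.
split=> //; last by lra.
rewrite ler_pdivrMl //; apply: le_trans h _.
have -> : normc v * (4 * r) = 2 * r * (2 * normc v) by ring.
exact: ler_wpM2l.
Qed.

Lemma curve_labels V xi eta (s t : R) (la lb : bool * bool -> R[i] -> nat) :
  0 < s -> 0 < t ->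
  (forall g p p', cell s g (la g p) p' = cell s g (la g p) p ->
    (la g p' <= la g p)%N) ->
  (forall g p p', cell t g (lb g p) p' = cell t g (lb g p) p ->
    (lb g p' <= lb g p)%N) ->
  affine_curve V xi eta \/ inversion_curve V xi eta ->
  exists lab : R[i] -> label_type, forall sd g h m, {in V &, forall u v,
    lab u = (sd, g, h, m) -> lab v = (sd, g, h, m) ->
    determined s t xi eta la lb sd g h u v}.
Proof.
move=> s0 t0 Ha Hb [[l l0 Hl]|[c [x Hx]]].
  have loc v r : v \in V ->
      r < 1 / 4 \/ ~ global_inversion (fun v => v \in V) xi eta (fun=> l)
        (fun=> 1) 0 0 ->
      locally_similar (fun v => v \in V) xi eta (fun=> l) (fun=> 1) v r /\
      locally_similar (fun v => v \in V) eta xi (fun=> 1) (fun=> l) v r.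
    move=> Vv _; split=> u Vu; have := normc_ge0 (eta u - eta v).
      by rewrite mul1r Hl // => h1 h2; split; lra.
    by rewrite mul1r Hl // => h1 h2; split; lra.
  have [lab Hlab] := exists_labels s0 t0 Ha Hb (fun _ _ => l0)
    (fun _ _ => ltr01) loc.
  by exists lab => sd g h m u v; apply: Hlab.
have V0 v : v \in V -> 0 < normc v by case/Hx => v0 _ _; rewrite normc_gt0.
have V0' v : v \in V -> 0 < (normc v)^-1 by move/V0; rewrite invr_gt0.
have Hi : global_inversion (fun v => v \in V) xi eta (fun v => (normc v)^-1)
    (fun v => normc v) c x.
  split=> v Vv; first by rewrite mulVf // gt_eqF // V0.
    by have [_ -> _] := Hx v Vv; rewrite addrK.
  by have [_ _ ->] := Hx v Vv; rewrite addrK ComplexField.Normc.normcV.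
have trB (p q w : R[i]) : p + w - (q + w) = p - q by rewrite opprD addrACA
  subrr addr0.
have loc v r : v \in V ->
    r < 1 / 4 \/ ~ global_inversion (fun v => v \in V) xi eta
      (fun v => (normc v)^-1) (fun v => normc v) c x ->
    locally_similar (fun v => v \in V) xi eta (fun v => (normc v)^-1) (fun v =>
      normc v) v r /\
    locally_similar (fun v => v \in V) eta xi (fun v => normc v) (fun v =>
      (normc v)^-1) v r.
  move=> Vv [r4|/(_ Hi)//]; split=> u Vu.
    have [u0 -> ->] := Hx u Vu; have [v0 -> ->] := Hx v Vv.
    rewrite !trB.
    case/(inversion_similar u0 v0 r4) => h1 h2 h3; split=> //.
      by rewrite ler_pdivlMr ?V0 // mulrC ler_pdivrMr ?V0.
    by rewrite ler_pdivlMr ?V0 // mulrC ler_pdivrMr ?V0.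
  have [u0 -> ->] := Hx u Vu; have [v0 -> ->] := Hx v Vv.
  rewrite !trB.
  (* Exchanging the coordinates replaces the parameter by its inverse, and the same estimate
     applies. *)
  have := @inversion_similar u^-1 v^-1 r; rewrite !invrK
    !ComplexField.Normc.normcV invrK !invr_eq0.
  move=> /(_ u0 v0 r4) H /H[h1 h2 h3]; split=> //.
    by rewrite ler_pdivlMr ?V0 // mulrC ler_pdivrMr ?V0 in h2.
  by rewrite ler_pdivlMr ?V0 // mulrC ler_pdivrMr ?V0 in h3.
have [lab Hlab] := exists_labels s0 t0 Ha Hb V0' V0 loc.
by exists lab => sd g h m u v; apply: Hlab.
Qed.

End JointClasses.

(** * Pairs of points in a common pair of classes *)

Section ClosePairs.
Local Open Scope nat_scope.

Variable R : realType.
Implicit Types (V P B : seq R[i]) (xi eta : R[i] -> R[i]).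

Lemma size_undup_pair (T : Type) (L : finType) (Q : eqType) (s : seq T)
    (lab : T -> L) (f : T -> Q) (m : nat) :
  (forall l, size (undup (map f [seq v <- s | lab v == l])) <= m) ->
  size (undup [seq (lab v, f v) | v <- s]) <= #|L| * m.
Proof.
move=> H; rewrite -sum1_size (partition_big (fun c => c.1) xpredT) //=.
rewrite -sum_nat_const leq_sum // => l _; apply: leq_trans (H l).
rewrite sum1_count -size_filter -(size_map snd).
apply: uniq_leq_size.
  rewrite map_inj_in_uniq ?filter_uniq ?undup_uniq // => -[l1 q1] [l2 q2].
  by rewrite !mem_filter /= => /andP[/eqP-> _] /andP[/eqP-> _] ->.
move=> q /mapP[[l1 q1]]; rewrite mem_filter mem_undup => /andP[/= /eqP-> +] ->.
move=> H1; rewrite mem_undup /=.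
elim: s H1 {H} => //= v s IH; rewrite inE => /orP[/eqP[<- ->]|/IH];
  first by rewrite eqxx mem_head.
by case: ifP => // _ h; rewrite inE h orbT.
Qed.

Lemma joint_class_pairs V P B xi eta (s t : R)
    (la lb : bool * bool -> R[i] -> nat) (n : nat) (lab : R[i] -> label_type) :
  uniq V -> {in V, forall v, xi v \in P} -> {in V, forall v, eta v \in B} ->
  (forall g, size (undup (map (grid_class s la g) P)) <= n) ->
  (forall g, size (undup (map (grid_class t lb g) B)) <= n) ->
  (forall sd g h m, {in V &, forall u v, lab u = (sd, g, h, m) ->
    lab v = (sd, g, h, m) -> determined s t xi eta la lb sd g h u v}) ->
  size V <= #|label_type| * n + \sum_(u <- V) \sum_(v <- V)
    ((u != v) && ([exists g : grid_id,
        grid_class s la g (xi u) == grid_class s la g (xi v)] &&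
      [exists g : grid_id,
        grid_class t lb g (eta u) == grid_class t lb g (eta v)]) : nat).
Proof.
move=> uV VP VB nA nB Hlab.
(* Only the class of the determining coordinate is kept: with the label it fixes both classes, so
   the pairs (label, class) number at most [#|label_type| * n] instead of about n^2. *)
pose f v := let: (sd, g, h, m) := lab v in
  if sd then grid_class s la g (xi v) else grid_class t lb h (eta v).
apply: leq_trans (size_undup_le_pairs (fun v => (lab v, f v)) uV) _.
apply: leq_add.
  apply: size_undup_pair => l.
  case: l => [[[sd g] h] m].
  set W := [seq _ <- _ | _].
  have WV v : v \in W -> v \in V by rewrite mem_filter => /andP[].
  have -> : map f W = if sd then map (grid_class s la g) (map xi W)
                      else map (grid_class t lb h) (map eta W).
    rewrite -!map_comp; case: ifP => sdE; apply/eq_in_map => v;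
    by rewrite mem_filter /f => /andP[/eqP -> _]; rewrite sdE.
  case: sd {W} (W) WV => W WV.
    apply: leq_trans (nA g); apply: uniq_leq_size; first exact: undup_uniq.
    move=> c; rewrite !mem_undup => /mapP[_ /mapP[v /WV Vv ->] ->].
    exact/map_f/VP.
  apply: leq_trans (nB h); apply: uniq_leq_size; first exact: undup_uniq.
  move=> c; rewrite !mem_undup => /mapP[_ /mapP[v /WV Vv ->] ->].
  exact/map_f/VB.
rewrite big_seq_cond [leqRHS]big_seq_cond.
apply: leq_sum => u /andP[Vu _].
rewrite big_seq_cond [leqRHS]big_seq_cond.
apply: leq_sum => v /andP[Vv _].
case: (u != v) => //=; case: eqP => //= -[elab ef].
have : lab u = lab u by [].
case E: {2}(lab u) => [[[sd g] h] m] Eu.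
have Ev : lab v = (sd, g, h, m) by rewrite -elab.
have := Hlab sd g h m u v Vu Vv Eu Ev.
rewrite /determined; move: ef; rewrite /f Eu Ev => ef D.
have /D[eA eB] : (if sd then grid_class s la g (xi u) = grid_class s la g (xi v)
  else grid_class t lb h (eta u) = grid_class t lb h (eta v)) by case: (sd) ef.
case: existsP => [_|[]]; last by exists g; apply/eqP.
by case: existsP => [_|[]] //; exists h; apply/eqP.
Qed.

Lemma sum_close P (s : R) (lev : bool * bool -> R[i] -> nat) (k : nat) :
  (forall g, {in P, forall p, count (fun p' => grid_class s lev g p' ==
     grid_class s lev g p) P <= k}) ->
  \sum_(p <- P) \sum_(p' <- P) ([exists g : grid_id,
    grid_class s lev g p == grid_class s lev g p'] : nat) <= 4 * k * size P.
Proof.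
move=> H; rewrite mulnC -sum1_size big_distrl /= big_seq_cond
  [leqRHS]big_seq_cond.
apply: leq_sum => p /andP[pP _]; rewrite mul1n.
have c4 : #|{: grid_id}| = 4 by rewrite card_prod !card_bool.
rewrite -c4 -sum_nat_const.
apply: (@leq_trans (\sum_(p' <- P) \sum_(g : grid_id)
    (grid_class s lev g p' == grid_class s lev g p : nat))).
  apply: leq_sum => p' _; case: existsP => //= -[g e].
  by rewrite (bigD1 g) //= eq_sym e.
rewrite exchange_big /=; apply: leq_sum => g _.
by apply: leq_trans (H g p pP); rewrite -sum1_count [leqRHS]big_mkcond.
Qed.

(* The relations depend on [P], [B], [K1] and [K2] only: they serve all curves
   at once. *)
Lemma exists_close_relations P B (K1 K2 : nat) : uniq P -> uniq B ->
  0 < K1 -> 0 < K2 -> exists closeP closeB : rel R[i],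
  [/\ \sum_(p <- P) \sum_(p' <- P) (closeP p p' : nat) <= 64 * K1 * size P,
      \sum_(p <- B) \sum_(p' <- B) (closeB p p' : nat) <= 64 * K2 * size B
    & forall V xi eta, uniq V ->
      {in V, forall v, xi v \in P} -> {in V, forall v, eta v \in B} ->
      affine_curve V xi eta \/ inversion_curve V xi eta ->
      size V <= #|label_type| * (size P %/ K1 + size B %/ K2 + 16) +
        \sum_(u <- V) \sum_(v <- V) ((u != v) &&
          (closeP (xi u) (xi v) && closeB (eta u) (eta v)) : nat)].
Proof.
move=> uP uB K10 K20.
have [s s0 /(_ K1 K10)[la Ha]] := exists_grid_classes uP.
have [t t0 /(_ K2 K20)[lb Hb]] := exists_grid_classes uB.
exists (fun p p' => [exists g : grid_id, grid_class s la g p == grid_class s la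
  g p']).
exists (fun p p' => [exists g : grid_id, grid_class t lb g p == grid_class t lb
  g p']).
split.
- have -> : 64 * K1 = 4 * (16 * K1) by lia.
  by apply: sum_close => g; have [] := Ha g.
- have -> : 64 * K2 = 4 * (16 * K2) by lia.
  by apply: sum_close => g; have [] := Hb g.
move=> V xi eta uV VP VB Hc.
have cA g p p' : cell s g (la g p) p' = cell s g (la g p) p -> la g p' <= la g
  p.
  by have [+ _ _] := Ha g; apply.
have cB g p p' : cell t g (lb g p) p' = cell t g (lb g p) p -> lb g p' <= lb g
  p.
  by have [+ _ _] := Hb g; apply.
have [lab Hlab] := curve_labels s0 t0 cA cB Hc.
apply: (joint_class_pairs uV VP VB _ _ Hlab) => g.
  have [_ _] := Ha g; rewrite -leq_divRL // divnDMl //.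
  by move=> h; apply: leq_trans h _; rewrite addnAC leq_addr.
have [_ _] := Hb g; rewrite -leq_divRL // divnDMl //.
by move=> h; apply: leq_trans h _; rewrite -addnA leq_addl.
Qed.

End ClosePairs.

(** * Incidences *)

Section Incidences.
Local Open Scope nat_scope.

Variables (R : realType).
Let C := R[i].
Variables (op : C -> C -> C) (f : C -> C) (beta : C -> C) (eta : C -> C -> C).
Variables (R0 A P S : seq C).
Hypotheses (uR0 : uniq R0) (uA : uniq A) (uS : uniq S).
Hypothesis op_injr : {in A, forall u, {in R0 &, injective (op u)}}.
Hypothesis op_injl : {in R0, forall c, {in A &, injective (op^~ c)}}.
Hypothesis beta_inj : {in R0 &, injective beta}.
Hypothesis beta_eta : {in A & R0, forall a b x,
  op (f a) b = x -> beta b = eta x a}.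

Definition on_curve c x a :=
  (op a c \in P) && has (fun b => op (f a) b == x) R0.

Definition curve c x := [seq a <- A | on_curve c x a].

(* Two points of [P] x [R0] lie on at most two curves; the parameter [u] of the
   first point is the root of a nonzero quadratic. *)
Hypothesis two_curves : forall p p', {in R0 &, forall b b',
  exists2 q : {poly C}, q != 0%R &
  (size q <= 3) /\ {in A & A & R0, forall u v c, u != v -> op u c = p ->
    op v c = p' -> op (f u) b = op (f v) b' -> root q u}}.

(** At most two values of [u] are roots; then [op u c = p] determines [c], and [op v c = p']
    determines [v]. *)
Lemma sum_curves_le2 p p' b b' : b \in R0 -> b' \in R0 ->
  \sum_(u <- A) \sum_(c <- R0) \sum_(v <- A)
    ([&& u != v, op u c == p, op v c == p' & op (f u) b == op (f v) b'] : nat)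
  <= 2.
Proof.
move=> bR b'R; have [q q0 [sq Hq]] := two_curves p p' bR b'R.
apply: (@leq_trans (\sum_(u <- A) (root q u : nat))).
  rewrite big_seq [leqRHS]big_seq; apply: leq_sum => u uA'.
  case ru: (root q u); last first.
    rewrite big_seq big1 // => c cR; rewrite big_seq big1 // => v vA.
    case: andP => // -[uv /and3P[/eqP h1 /eqP h2 /eqP h3]].
    by rewrite (Hq u v c) in ru.
  apply: (@leq_trans (\sum_(c <- R0) (op u c == p : nat))).
    rewrite big_seq [leqRHS]big_seq; apply: leq_sum => c cR.
    case: eqP => [e|_] /=; last by rewrite big1 // => v _; rewrite andbF.
    apply: sum_le1 => // v v' vA v'A /and3P[_ /eqP h _] /and3P[_ /eqP h' _].
    by apply: (op_injl cR) => //; rewrite h h'.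
  apply: sum_le1 => // c c' cR c'R /eqP h /eqP h'.
  by apply: (op_injr uA') => //; rewrite h h'.
rewrite -big_mkcond -big_filter sum1_size -ltnS; apply: leq_trans sq.
by apply: max_poly_roots => //; [apply/allP => u;
  rewrite mem_filter => /andP[]|apply: filter_uniq].
Qed.

(** Double counting: a pair of points on the curve [(c, x)] is sorted by its coordinates [p], [p']
    in [P] and [b], [b'] in [R0]. The value [x = op (f u) b] is recovered from [u] and [b], and
    [sum_curves_le2] bounds the rest. *)
Lemma sum_close_pairs_le (closeP closeB : rel C) :
  \sum_(c <- R0) \sum_(x <- S) \sum_(u <- curve c x) \sum_(v <- curve c x)
    ((u != v) && (closeP (op u c) (op v c) && closeB (eta x u) (eta x v)) : nat)
  <= 2 * ((\sum_(p <- P) \sum_(p' <- P) (closeP p p' : nat)) *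
          (\sum_(b <- R0) \sum_(b' <- R0) (closeB (beta b) (beta b') : nat))).
Proof.
pose G u v := \sum_(b <- R0) \sum_(b' <- R0)
  (closeB (beta b) (beta b') && (op (f u) b == op (f v) b') : nat).
pose D c u v := [&& u != v, op u c \in P, op v c \in P & closeP (op u c) (op v
  c)].
apply: (@leq_trans (\sum_(c <- R0) \sum_(u <- A) \sum_(v <- A) D c u v * G u
  v)).
  apply: leq_sum => c _.
  under eq_bigr => x _ do (rewrite big_filter big_mkcond /=;
    under eq_bigr => u _ do rewrite big_filter big_mkcond /=).
  rewrite exchange_big /= big_seq [leqRHS]big_seq; apply: leq_sum => u uA'.
  apply: (@leq_trans (\sum_(v <- A) \sum_(x <- S)
     (D c u v && [&& has (fun b => op (f u) b == x) R0,
       has (fun b => op (f v) b == x) R0 &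
        closeB (eta x u) (eta x v)] : nat))).
    rewrite exchange_big /=; apply: leq_sum => x _.
    rewrite /on_curve /D; case: (op u c \in P) => /=; last first.
      by [].
    case: (has _ R0) => //=.
    apply: leq_sum => v _; case: (op v c \in P) => //=; last first.
    case: (has _ R0) => //=.
    by case: (u != v) => //=; case: (closeP _ _).
  rewrite big_seq [leqRHS]big_seq; apply: leq_sum => v vA.
  case: (D c u v); last by rewrite big1.
  rewrite mul1n /G.
  apply: (@leq_trans (\sum_(x <- S) \sum_(b <- R0) \sum_(b' <- R0)
     (closeB (beta b) (beta b') && ((op (f u) b == x) && (op (f v) b' == x)) :
       nat))).
    apply: leq_sum => x _.
    case: hasP => //= -[b bR /eqP eb]; case: hasP => //= -[b' b'R /eqP eb'].
    rewrite -(beta_eta uA' bR eb) -(beta_eta vA b'R eb').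
    case cB: (closeB _ _) => //.
    rewrite (big_rem b) //= (big_rem b' b'R) /= cB eb eb' eqxx //.
  rewrite exchange_big /=; apply: leq_sum => b _.
  rewrite exchange_big /=; apply: leq_sum => b' _.
  by case: (closeB _ _) => /=; [apply: sum_eq2_le|rewrite big1].
apply: (@leq_trans (\sum_(b <- R0) \sum_(b' <- R0) closeB (beta b) (beta b') *
   \sum_(c <- R0) \sum_(u <- A) \sum_(v <- A) (D c u v && (op (f u) b == op (f
     v) b')))).
  rewrite /G.
  under eq_bigr => c _ do under eq_bigr => u _ do
    under eq_bigr => v _ do rewrite big_distrr /=.
  under eq_bigr => c _ do under eq_bigr => u _ do rewrite exchange_big /=.
  under eq_bigr => c _ do rewrite exchange_big /=.
  rewrite exchange_big /=; apply: leq_sum => b _.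
  under eq_bigr => c _ do under eq_bigr => u _ do
    under eq_bigr => v _ do rewrite big_distrr /=.
  under eq_bigr => c _ do under eq_bigr => u _ do rewrite exchange_big /=.
  under eq_bigr => c _ do rewrite exchange_big /=.
  rewrite exchange_big /=; apply: leq_sum => b' _.
  rewrite big_distrr /=; apply: leq_sum => c _.
  rewrite big_distrr /=; apply: leq_sum => u _.
  rewrite big_distrr /=; apply: leq_sum => v _.
  by case: (D c u v); case: (closeB _ _); case: (_ == _).
rewrite mulnA [leqRHS]mulnC big_distrl /= big_seq [leqRHS]big_seq.
apply: leq_sum => b bR; rewrite big_distrl /= big_seq [leqRHS]big_seq.
apply: leq_sum => b' b'R; rewrite leq_mul2l; apply/orP; right.
apply: (@leq_trans (\sum_(c <- R0) \sum_(u <- A) \sum_(v <- A) \sum_(p <- P)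
  \sum_(p' <- P)
   closeP p p' * ([&& u != v, op u c == p, op v c == p' & op (f u) b == op (f
     v) b']))).
  apply: leq_sum => c _; apply: leq_sum => u _; apply: leq_sum => v _.
  case: andP => //= -[/and4P[uv uP' vP cP] e].
  by rewrite (big_rem _ uP') /= (big_rem _ vP) /= cP uv e !eqxx.
rewrite mulnC big_distrl /=.
under eq_bigr => c _ do under eq_bigr => u _ do rewrite exchange_big /=.
under eq_bigr => c _ do rewrite exchange_big /=.
rewrite exchange_big /=; apply: leq_sum => p _.
rewrite big_distrl /=.
under eq_bigr => c _ do under eq_bigr => u _ do rewrite exchange_big /=.
under eq_bigr => c _ do rewrite exchange_big /=.
rewrite exchange_big /=; apply: leq_sum => p' _.
apply: leq_trans (leq_mul (leqnn (closeP p p' : nat)) (sum_curves_le2 p p' bR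
  b'R)).
rewrite exchange_big big_distrr /=; apply: leq_sum => u _.
rewrite big_distrr /=; apply: leq_sum => c _.
by rewrite big_distrr.
Qed.

(** By injectivity of [beta], each [a] admits at most one [b]. *)
Lemma richnessE c x : richness op f R0 A P c x = size (curve c x).
Proof.
rewrite /richness /curve size_filter -sum1_count [RHS]big_mkcond /=.
rewrite big_seq [RHS]big_seq; apply: eq_bigr => a aA.
rewrite /on_curve; case: (op a c \in P) => /=; last by rewrite big1.
case: hasP => [[b bR e]|nb]; last first.
  by rewrite big_seq big1 // => b bR; case: eqP => // e; case: nb;
    exists b => //; apply/eqP.
apply/eqP; rewrite eqn_leq; apply/andP; split;
  last by rewrite (big_rem b bR) /= e.
apply: sum_le1 => // b1 b2 b1R b2R /eqP e1 /eqP e2; apply: beta_inj => //.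
by rewrite (beta_eta aA b1R e1) (beta_eta aA b2R e2).
Qed.

End Incidences.

(** [K] is the least integer above 4 c m / kap, so that [m %/ K] classes cost at most a quarter of
    [kap]; the rounding up is absorbed by [kap <= m]. *)
Lemma exists_scale (R : realType) (c m : nat) (kap : R) :
  0 < kap -> kap <= m%:R ->
  exists2 K, (0 < K)%N &
    4 * c%:R * (m %/ K)%:R <= kap /\ K%:R * kap <= (4 * c + 1)%:R * m%:R.
Proof.
move=> kap0 km; set y := 4 * c%:R * m%:R / kap.
have y0 : 0 <= y by rewrite divr_ge0 ?mulr_ge0 // ltW.
exists (Num.truncn y).+1 => //; set K := (Num.truncn y).+1.
have m0 : 0 < m%:R :> R by apply: lt_le_trans km.
have yK : y < K%:R by apply: truncnS_gt.
split.
  have h : (m %/ K)%:R * K%:R <= m%:R :> R by rewrite -natrM ler_nat leq_divM.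
  rewrite -(ler_pM2r m0).
  have h1 : 4 * c%:R * m%:R <= K%:R * kap by rewrite -ler_pdivrMr // ltW.
  have h2 := ler_wpM2l (ler0n R (m %/ K)) h1.
  have h3 := ler_wpM2r (ltW kap0) h.
  move: (m %/ K)%:R (K%:R) h h1 h2 h3 => q k h h1 h2 h3; lra.
have h1 : K%:R <= y + 1 by rewrite -natr1 lerD2r truncn_le.
have h2 : K%:R * kap <= (y + 1) * kap by rewrite ler_pM2r.
apply: le_trans h2 _; rewrite mulrDl mul1r divfK ?gt_eqF // natrD natrM; lra.
Qed.

(** Chosen so that the 16 extra classes, times [#|label_type|], also cost at most [kap / 4]. *)
Definition min_richness (R : realType) : R := 64 * #|label_type|%:R.

Definition incidence_constant (R : realType) : R :=
  8 * 64 ^+ 2 * (4 * #|label_type| + 1)%:R ^+ 2.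

Section IncidenceBound.

Variables (R : realType).
Let C := R[i].
Variables (op : C -> C -> C) (f : C -> C) (beta : C -> C) (eta : C -> C -> C).
Variables (R0 A P S : seq C).
Hypotheses (uR0 : uniq R0) (uA : uniq A) (uP : uniq P) (uS : uniq S).
Hypothesis AR0 : {subset A <= R0}.
Hypothesis op_injr : {in A, forall u, {in R0 &, injective (op u)}}.
Hypothesis op_injl : {in R0, forall c, {in A &, injective (op^~ c)}}.
Hypothesis beta_inj : {in R0 &, injective beta}.
Hypothesis beta_eta : {in A & R0, forall a b x,
  op (f a) b = x -> beta b = eta x a}.
Hypothesis curveP : {in R0 & S, forall c x,
  affine_curve (curve op f R0 A P c x) (op^~ c) (eta x) \/
  inversion_curve (curve op f R0 A P c x) (op^~ c) (eta x)}.
Hypothesis two_curves : forall p p', {in R0 &, forall b b',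
  exists2 q : {poly C}, q != 0%R &
  (size q <= 3)%N /\ {in A & A & R0, forall u v c, u != v -> op u c = p ->
    op v c = p' -> op (f u) b = op (f v) b' -> root q u}}.

Let k := richness op f R0 A P.
Let L := #|label_type|.

(** On a curve with [k c x >= kap] points, the three terms of the class count amount to at most 3/4
    of [kap], so at least a quarter of [k c x] is matched by close pairs. Summed over the curves,
    this is the Szemeredi-Trotter estimate for rich curves: their number is O(|P|^2 |R0|^2 /
    kap^3). *)
Lemma incidence_bound (kap : R) : 0 < kap -> min_richness R <= kap ->
  (\sum_(c <- R0) \sum_(x <- S) (if kap <= (k c x)%:R then (k c x)%:R else 0))
    * kap ^+ 2
  <= incidence_constant R * (size P)%:R ^+ 2 * (size R0)%:R ^+ 2.
Proof.
rewrite /min_richness /incidence_constant -/L.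
move=> kap0 Lkap.
have kP c x : c \in R0 -> (k c x <= size P)%N.
  move=> cR; rewrite /k (richnessE P uR0 beta_inj beta_eta) -(size_map (op^~ c)
    (curve op f R0 A P c x)).
  apply: uniq_leq_size.
    rewrite map_inj_in_uniq ?filter_uniq // => a a'; rewrite !mem_filter.
    by move=> /andP[_ aA] /andP[_ a'A]; apply: op_injl.
  move=> y /mapP[a aV ->]; move: aV; rewrite mem_filter.
  by case/andP => /andP[].
have kn c x : (k c x <= size R0)%N.
  rewrite /k (richnessE P uR0 beta_inj beta_eta).
  apply: uniq_leq_size; first exact: filter_uniq.
  by move=> a; rewrite mem_filter => /andP[_ /AR0].
have rhs0 : 0 <= 8 * 64 ^+ 2 * (4 * L + 1)%:R ^+ 2 * (size P)%:R ^+ 2 * (size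
  R0)%:R ^+ 2 :> R.
  by rewrite !mulr_ge0 ?exprn_ge0.
(* A curve has at most [size P] and at most [size R0] points, so for larger [kap] the sum is empty;
   [exists_scale] needs [kap] below both. *)
have [kapP|kapP] := leP kap (size P)%:R; last first.
  rewrite big_seq big1 ?mul0r // => c cR; rewrite big1 // => x _.
  by rewrite leNgt (le_lt_trans _ kapP) // ler_nat kP.
have [kapn|kapn] := leP kap (size R0)%:R; last first.
  rewrite big1 ?mul0r // => c _; rewrite big1 // => x _.
  by rewrite leNgt (le_lt_trans _ kapn) // ler_nat kn.
have [K1 K10 [q1 k1]] := exists_scale L kap0 kapP.
have [K2 K20 [q2 k2]] := exists_scale L kap0 kapn.
have uB : uniq (map beta R0) by rewrite map_inj_in_uniq.
have [cP [cB [sP sB Hc]]] := exists_close_relations uP uB K10 K20.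
rewrite size_map in sB Hc.
pose pairs c x := (\sum_(u <- curve op f R0 A P c x) \sum_(v <- curve op f R0 A
  P c x)
    ((u != v) && (cP (op u c) (op v c) && cB (eta x u) (eta x v)) : nat))%N.
have tot : (\sum_(c <- R0) \sum_(x <- S) pairs c x <=
    2 * ((64 * K1 * size P) * (64 * K2 * size R0)))%N.
  apply: leq_trans (sum_close_pairs_le P uR0 uA uS op_injr op_injl beta_eta
    two_curves cP cB) _.
  rewrite leq_mul2l; apply: leq_mul => //.
  apply: leq_trans sB; rewrite big_map; apply: leq_sum => b _.
  by rewrite big_map.
have main : \sum_(c <- R0) \sum_(x <- S) (if kap <= (k c x)%:R then (k c x)%:R
  else 0)
    <= 4 * (\sum_(c <- R0) \sum_(x <- S) pairs c x)%N%:R :> R.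
  rewrite natr_sum mulr_sumr big_seq [leRHS]big_seq; apply: ler_sum => c cR.
  rewrite natr_sum mulr_sumr big_seq [leRHS]big_seq; apply: ler_sum => x xS.
  case: ifP => [kk|_]; last by rewrite mulr_ge0.
  have := Hc (curve op f R0 A P c x) (op^~ c) (eta x).
  rewrite -(richnessE P uR0 beta_inj beta_eta) -/(k c x) -/(pairs c x).
  have h1 : {in curve op f R0 A P c x, forall v, op v c \in P}.
    by move=> v; rewrite mem_filter => /andP[/andP[]].
  have h2 : {in curve op f R0 A P c x, forall v, eta x v \in map beta R0}.
    move=> v; rewrite mem_filter => /andP[/andP[_ /hasP[b bR /eqP e]] vA].
    by rewrite -(beta_eta vA bR e) map_f.
  move=> /(_ (filter_uniq _ uA) h1 h2 (curveP cR xS)).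
  rewrite -(ler_nat R) natrD natrM !natrD -/L.
  move: (pairs c x)%:R (k c x)%:R (L%:R) (_ %/ K1)%:R (_ %/ K2)%:R kk q1 q2
    Lkap => p K l a b kk q1 q2 Lkap H.
  have : l * (a + b + 16) = l * a + l * b + 16 * l by ring.
  lra.
have tot' : (\sum_(c <- R0) \sum_(x <- S) pairs c x)%N%:R <=
   2 * 64 ^+ 2 * (K1%:R * K2%:R) * ((size P)%:R * (size R0)%:R) :> R.
  apply: le_trans (_ : (2 * ((64 * K1 * size P) * (64 * K2 * size R0)))%N%:R <=
    _).
    by rewrite ler_nat.
  by rewrite !natrM le_eqVlt; apply/orP; left; apply/eqP; ring.
have kk : (K1%:R * kap) * (K2%:R * kap) <=
    ((4 * L + 1)%:R * (size P)%:R) * ((4 * L + 1)%:R * (size R0)%:R).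
  by apply: ler_pM => //; rewrite mulr_ge0 // ltW.
apply: le_trans (ler_wpM2r _ main) _; first exact: exprn_ge0 (ltW kap0).
apply: le_trans (ler_wpM2r _ (ler_wpM2l _ tot')) _ => //.
  exact: exprn_ge0 (ltW kap0).
have h0 : 0 <= 8 * 64 ^+ 2 * ((size P)%:R * (size R0)%:R) :> R.
  by rewrite !mulr_ge0 ?exprn_ge0.
apply: (le_trans _ (le_trans (ler_wpM2l h0 kk) _));
  by rewrite le_eqVlt; apply/orP; left; apply/eqP; ring.
Qed.

End IncidenceBound.

(** * Energies *)

Section StructuredPieces.

Variables (R : realType) (T : eqType) (op : T -> T -> T) (f : T -> T).
Variables (R0 S : seq T).
Hypotheses (uR0 : uniq R0) (uS : uniq S).
Hypothesis op_inj : {in R0, forall a, {in R0 &, injective (op a)}}.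
Hypothesis f_R0 : {in R0, forall a, f a \in R0}.
Hypothesis f_inj : {in R0 &, injective f}.

Variables (C2 C3 nu : R) (l : nat).
Hypotheses (C2_gt0 : 0 < C2) (C3_ge1 : 1 <= C3) (nu_ge1 : 1 <= nu).
(** Working with the fourth root turns the quarter powers of [size R0] into integer powers: the
    target exponent 11/4 becomes [nu ^+ 11]. *)
Hypothesis nuE : nu ^+ 4 = (size R0)%:R.
Hypothesis sizeR0 : (size R0 < 2 ^ l)%N.

Hypothesis incidences : forall A P : seq T, uniq A -> uniq P ->
  {subset A <= R0} -> forall kap : R, 0 < kap -> C2 <= kap ->
  (\sum_(c <- R0) \sum_(x <- S)
     (if kap <= (richness op f R0 A P c x)%:R
      then (richness op f R0 A P c x)%:R else 0)) * kap ^+ 2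
  <= C3 * (size P)%:R ^+ 2 * (size R0)%:R ^+ 2.

Let n := size R0.
Let energy F G := (\sum_(x <- S) rep op F G x ^ 2)%N.

Lemma l_gt0 : (0 < l)%N.
Proof.
have : (0 < size R0)%N.
  by rewrite -(ltr_nat R) -nuE exprn_gt0 // (lt_le_trans ltr01).
by case: l sizeR0 => //; rewrite expn0; case: (size R0).
Qed.

Lemma rep_le F G x : uniq G -> {subset F <= R0} -> {subset G <= R0} ->
  (rep op F G x <= size F)%N.
Proof.
move=> uG FR GR; apply: rep_le_size => // a /FR aR b b' /GR bR /GR b'R.
exact: op_inj.
Qed.

Lemma sub_size A : uniq A -> {subset A <= R0} -> (size A <= n)%N.
Proof. exact: uniq_leq_size. Qed.

Lemma richness_sum A P x :
  (\sum_(c <- R0) richness op f R0 A P c x =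
   \sum_(a <- A) (\sum_(c <- R0) (op a c \in P)) *
      (\sum_(b <- R0) (op (f a) b == x)))%N.
Proof.
rewrite /richness exchange_big /=; apply: eq_bigr => a _.
rewrite big_distrl /=; apply: eq_bigr => c _; rewrite big_distrr /=.
by apply: eq_bigr => b _; case: (_ \in _); case: (_ == _).
Qed.

(** As each [a] has at least [t] partners [c], [t * rep] is at most the sum of richness over [c].
    The curves poorer than [kap = t T0 / (2 n)] contribute at most [t T0 / 2], half of the total
    wherever [rep >= T0]; the rich ones fall under [incidences]. *)
Lemma image_rep_bound A P (t : nat) (T0 : nat) : uniq A -> uniq P ->
  {subset A <= R0} -> (0 < t)%N ->
  {in A, forall a, t <= \sum_(c <- R0) (op a c \in P)}%N ->
  2 * n%:R * C2 <= t%:R * T0%:R :> R ->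
  (\sum_(x <- S | (T0 <= rep op (map f A) R0 x)%N) rep op (map f A) R0 x)%:R *
    T0%:R ^+ 2 * t%:R ^+ 3 <= 8 * C3 * (size P)%:R ^+ 2 * n%:R ^+ 4 :> R.
Proof.
move=> uA uP AR t0 ht hT.
have n0 : 0 < n%:R :> R by rewrite -nuE exprn_gt0 // (lt_le_trans ltr01).
set kap := t%:R * T0%:R / (2 * n%:R) : R.
have kapE : kap * (2 * n%:R) = t%:R * T0%:R by rewrite divfK // mulf_neq0 //
  gt_eqF.
have C2kap : C2 <= kap by rewrite ler_pdivlMr ?mulr_gt0 // mulrC.
have kap0 : 0 < kap by apply: lt_le_trans C2kap.
have := incidences uA uP AR kap0 C2kap.
set Sum := \sum_(c <- _) _ => inc.
set Q := (\sum_(x <- S | _) _)%N.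
have QS : t%:R * Q%:R <= 2 * Sum.
  rewrite /Sum exchange_big /= /Q natr_sum mulr_sumr mulr_sumr.
  rewrite big_mkcond /=; apply: ler_sum => x _.
  case: ifP => [Tr|_]; last first.
    by rewrite mulr_ge0 // sumr_ge0 // => c _; case: ifP.
  have h1 : (t * rep op (map f A) R0 x <= \sum_(c <- R0) richness op f R0 A P c
    x)%N.
    rewrite richness_sum /rep big_map big_distrr /= big_seq [leqRHS]big_seq.
    by apply: leq_sum => a aA; rewrite leq_mul2r ht ?orbT.
  have h2 : (\sum_(c <- R0) richness op f R0 A P c x)%:R <= n%:R * kap +
     \sum_(c <- R0) (if kap <= (richness op f R0 A P c x)%:R
       then (richness op f R0 A P c x)%:R else 0).
    have -> : n%:R * kap = \sum_(c <- R0) kap.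
      by rewrite big_const_seq count_predT iter_addr_0 mulr_natl.
    rewrite natr_sum -big_split /=; apply: ler_sum => c _.
    by case: ifP => [_|/negbT]; [rewrite lerDr ltW|rewrite -ltNge addr0 =>
      /ltW].
  have h3 : t%:R * (rep op (map f A) R0 x)%:R <= (\sum_(c <- R0) richness op f
    R0 A P c x)%:R :> R.
    by rewrite -natrM ler_nat.
  have h4 : t%:R * T0%:R <= t%:R * (rep op (map f A) R0 x)%:R :> R.
    by rewrite ler_wpM2l // ler_nat.
  lra.
have t0' : 0 < t%:R :> R by rewrite ltr0n.
have h5 : (t%:R * Q%:R) * kap ^+ 2 <= 2 * (C3 * (size P)%:R ^+ 2 * n%:R ^+ 2).
  apply: le_trans (ler_wpM2r _ QS) _; first exact: exprn_ge0 (ltW kap0).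
  by rewrite -[leLHS]mulrA ler_pM2l.
have h6 : 0 <= 4 * n%:R ^+ 2 :> R by rewrite mulr_ge0 ?exprn_ge0.
have := ler_wpM2r h6 h5.
have -> : t%:R * Q%:R * kap ^+ 2 * (4 * n%:R ^+ 2) = t%:R * Q%:R * (kap * (2 *
  n%:R)) ^+ 2.
  by ring.
rewrite kapE => h7.
apply: le_trans (le_trans h7 _); rewrite le_eqVlt; apply/orP; left; apply/eqP;
  ring.
Qed.

(** Large energy with [p * tau <= nu ^+ 8] forces tau >= nu^3 / (4 L), hence p tau^3 >= nu^14 / (16
    L^2). The cube of [p * tau <= 2 * L * al * t] then eliminates [t] from the incidence
    alternative. The first alternative covers curves too poor for the incidence bound. *)
Lemma piece_energy_arith (E1 E2 p t tau al L : R) : 0 < p -> 0 < t -> 0 < tau ->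
  0 < al -> 1 <= L -> 0 <= E2 ->
  nu ^+ 11 < E1 -> E1 <= 4 * L * p * tau ^+ 2 -> p * tau <= 2 * L * al * t ->
  p * tau <= nu ^+ 8 -> tau <= nu ^+ 4 ->
  E2 * t <= 4 * C2 * L * nu ^+ 8 * al \/
  E2 ^+ 2 * t ^+ 3 <= 32 * L ^+ 2 * C3 * al * p ^+ 2 * nu ^+ 20 ->
  E2 <= (64 * C3 + 32 * C2) * L ^+ 4 * nu ^+ 3 * al ^+ 2.
Proof.
move=> p0 t0 tau0 al0 L1 E20 h1 h2 h3 h4 h5.
have nu0 : 0 < nu by apply: lt_le_trans nu_ge1.
have L0 : 0 < L by apply: lt_le_trans L1.
have C30 : 0 < C3 by apply: lt_le_trans C3_ge1.
have pt0 : 0 < p * tau by rewrite mulr_gt0.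
have g1 : nu ^+ 11 <= 4 * L * tau * (p * tau).
  by apply: ltW; apply: lt_le_trans h1 (le_trans h2 _); rewrite le_eqVlt;
    apply/orP; left; apply/eqP; ring.
have X (k : nat) : 0 < nu ^+ k by apply: exprn_gt0.
case.
  move=> e1.
  have g2 : nu ^+ 7 <= 4 * L * (p * tau).
    rewrite -(ler_pM2r (X 4)) -exprD; apply: le_trans g1 _.
    have -> : 4 * L * tau * (p * tau) = 4 * L * (p * tau) * tau by ring.
    by rewrite ler_pM2l // !mulr_gt0.
  have g3 : nu ^+ 7 <= 8 * L ^+ 2 * al * t.
    apply: le_trans g2 _.
    have -> : 8 * L ^+ 2 * al * t = 4 * L * (2 * L * al * t) by ring.
    by rewrite ler_pM2l // mulr_gt0.
  have g4 : E2 * nu ^+ 7 <= 32 * C2 * L ^+ 3 * nu ^+ 8 * al ^+ 2.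
    apply: le_trans (ler_wpM2l E20 g3) _.
    have -> : E2 * (8 * L ^+ 2 * al * t) = 8 * L ^+ 2 * al * (E2 * t) by ring.
    apply: le_trans (ler_wpM2l _ e1) _; first by rewrite !mulr_ge0 ?exprn_ge0
      // ltW.
    by rewrite le_eqVlt; apply/orP; left; apply/eqP; ring.
  have g5 : E2 <= 32 * C2 * L ^+ 3 * nu * al ^+ 2.
    rewrite -(ler_pM2r (X 7)); apply: le_trans g4 _.
    by rewrite le_eqVlt; apply/orP; left; apply/eqP; ring.
  apply: le_trans g5 _; rewrite ler_pM2r ?exprn_gt0 //.
  have k1 : 32 * C2 * L ^+ 3 <= (64 * C3 + 32 * C2) * L ^+ 4.
    have k2 : L ^+ 3 <= L ^+ 4 by rewrite ler_weXn2l.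
    apply: ler_pM => //; rewrite ?mulr_ge0 ?exprn_ge0 ?ltW //; lra.
  have k2 : nu <= nu ^+ 3 by rewrite -{1}(expr1 nu) ler_weXn2l.
  by apply: ler_pM => //; rewrite ?mulr_ge0 ?exprn_ge0 ?ltW.
move=> e2.
have g2 : nu ^+ 3 <= 4 * L * tau.
  rewrite -(ler_pM2r (X 8)) -exprD; apply: le_trans g1 _.
  by rewrite ler_pM2l // !mulr_gt0.
have g3 : nu ^+ 14 <= 16 * L ^+ 2 * (p * tau ^+ 3).
  have -> : nu ^+ 14 = nu ^+ 11 * nu ^+ 3 by rewrite -exprD.
  apply: le_trans (ler_pM (ltW (X 11)) (ltW (X 3)) g1 g2) _.
  by rewrite le_eqVlt; apply/orP; left; apply/eqP; ring.
have g4 : (p * tau) ^+ 3 <= (2 * L * al * t) ^+ 3.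
  by rewrite lerXn2r // nnegrE ltW // !mulr_gt0.
have g5 : p ^+ 2 * (E2 ^+ 2 * (p * tau ^+ 3)) <= p ^+ 2 * (256 * L ^+ 5 * C3 *
  al ^+ 4 * nu ^+ 20).
  have -> : p ^+ 2 * (E2 ^+ 2 * (p * tau ^+ 3)) = E2 ^+ 2 * (p * tau) ^+ 3 by
    ring.
  apply: le_trans (ler_wpM2l _ g4) _; first exact: exprn_ge0.
  have -> : E2 ^+ 2 * (2 * L * al * t) ^+ 3 = 8 * L ^+ 3 * al ^+ 3 * (E2 ^+ 2 *
    t ^+ 3) by ring.
  apply: le_trans (ler_wpM2l _ e2) _; first by rewrite !mulr_ge0 ?exprn_ge0 //
    ltW.
  by rewrite le_eqVlt; apply/orP; left; apply/eqP; ring.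
rewrite ler_pM2l ?exprn_gt0 // in g5.
have g6 : E2 ^+ 2 * nu ^+ 14 <= 4096 * L ^+ 7 * C3 * al ^+ 4 * nu ^+ 20.
  apply: le_trans (ler_wpM2l _ g3) _; first exact: exprn_ge0.
  have -> : E2 ^+ 2 * (16 * L ^+ 2 * (p * tau ^+ 3)) = 16 * L ^+ 2 * (E2 ^+ 2 *
    (p * tau ^+ 3)) by ring.
  apply: le_trans (ler_wpM2l _ g5) _; first by rewrite !mulr_ge0 ?exprn_ge0 //
    ltW.
  by rewrite le_eqVlt; apply/orP; left; apply/eqP; ring.
have g7 : E2 ^+ 2 <= 4096 * L ^+ 7 * C3 * al ^+ 4 * nu ^+ 6.
  rewrite -(ler_pM2r (X 14)); apply: le_trans g6 _.
  by rewrite le_eqVlt; apply/orP; left; apply/eqP; ring.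
have g8 : E2 ^+ 2 <= (64 * C3 * L ^+ 4 * nu ^+ 3 * al ^+ 2) ^+ 2.
  apply: le_trans g7 _.
  have -> : (64 * C3 * L ^+ 4 * nu ^+ 3 * al ^+ 2) ^+ 2 = 4096 * L ^+ 7 * C3 *
    al ^+ 4 * nu ^+ 6 * (L * C3) by ring.
  rewrite ler_peMr ?mulr_ege1 //.
  by rewrite !mulr_ge0 ?exprn_ge0 ?ltW.
have g9 : E2 <= 64 * C3 * L ^+ 4 * nu ^+ 3 * al ^+ 2.
  rewrite -(@ler_pXn2r _ 2) ?nnegrE //.
  by rewrite !mulr_ge0 ?exprn_ge0 ?ltW.
apply: le_trans g9 _; rewrite !ler_pM2r ?exprn_gt0 //. by rewrite lerDl
  mulr_ge0 // ltW.
Qed.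

Lemma sum_dyadic_le (s : seq T) (w : T -> nat) (j : nat) :
  (\sum_(x <- s | 2 ^ j <= w x < 2 ^ j.+1) w x <=
   size [seq x <- s | 2 ^ j <= w x < 2 ^ j.+1] * (2 * 2 ^ j))%N.
Proof.
rewrite -big_filter -sum1_size big_distrl /= big_seq [leqRHS]big_seq.
apply: leq_sum => x; rewrite mem_filter expnS => /andP[/andP[_ h] _].
by rewrite mul1n ltnW.
Qed.

Lemma sum_dyadic_sqr_le (s : seq T) (w : T -> nat) (j : nat) :
  (\sum_(x <- s | 2 ^ j <= w x < 2 ^ j.+1) w x ^ 2 <=
   2 * 2 ^ j * \sum_(x <- s | 2 ^ j <= w x) w x)%N.
Proof.
rewrite big_distrr /= big_mkcond [leqRHS]big_mkcond; apply: leq_sum => x _.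
case: (leqP (2 ^ j) (w x)) => //= _; case: ifP => //; rewrite expnS => h.
by rewrite leq_mul2r ltnW ?orbT.
Qed.

Definition energy_scale : R := (64 * C3 + 32 * C2) * l%:R ^+ 4 * nu ^+ 3.

(** Three dyadic choices: the popular values [P] of height [tau] in [X], the elements [A] with about
    [t] partners into [P], and the height [T0] that carries the energy of [map f A] with [R0]. *)
Lemma exists_structured_piece (X : seq T) : uniq X -> {subset X <= R0} ->
  nu ^+ 11 < (energy X X)%:R -> exists A, [/\ (0 < size A)%N, uniq A,
    {subset A <= X} &
    (energy (map f A) R0)%:R <= energy_scale * (size A)%:R ^+ 2].
Proof.
move=> uX XR hE.
have l0 := l_gt0.
have Xn : (size X <= n)%N by apply: sub_size.
have repX x : (rep op X X x <= n)%N by apply: leq_trans Xn; apply: rep_le.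
have [|x xS ->|j] := @dyadic_pigeonhole _ S (rep op X X) (fun x => rep op X X x
  ^ 2)%N l l0.
- by move=> x _; apply: leq_ltn_trans sizeR0.
- by [].
set P := [seq x <- S | (2 ^ j <= rep op X X x < 2 ^ j.+1)%N].
set tau := (2 ^ j)%N => hj.
have uP : uniq P by apply: filter_uniq.
have E1 : (energy X X <= l * (4 * size P * tau ^ 2))%N.
  apply: leq_trans hj _; rewrite leq_mul2l; apply/orP; right.
  rewrite -big_filter -/P mulnAC -sum1_size big_distrr /= big_seq
    [leqRHS]big_seq.
  apply: leq_sum => x; rewrite mem_filter expnS => /andP[/andP[_ h] _].
  rewrite muln1 -[4%N]/(2 ^ 2)%N -expnMn leq_exp2r // ltnW //.
have P0 : (0 < size P)%N.
  rewrite lt0n; apply: contraTneq hE => P0.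
  move: E1; rewrite P0 muln0 mul0n muln0 leqn0 => /eqP ->.
  by rewrite -leNgt exprn_ge0 // (le_trans ler01).
pose d a := (\sum_(c <- X) (op a c \in P))%N.
have dsum : (\sum_(a <- X) d a = \sum_(x <- P) rep op X X x)%N.
  rewrite [RHS]exchange_big /=; apply: eq_bigr => a _.
  rewrite exchange_big /=; apply: eq_bigr => c _.
  by rewrite sum_eq_uniq.
have ptau : (size P * tau <= \sum_(x <- P) rep op X X x)%N.
  rewrite -sum1_size big_distrl /= big_seq [leqRHS]big_seq.
  by apply: leq_sum => x; rewrite mem_filter mul1n => /andP[/andP[]].
have dle a : (d a <= size X)%N.
  by rewrite /d -sum1_size; apply: leq_sum => c _; case: (_ \in _).
have [|a aX //|i] := @dyadic_pigeonhole _ X d d l l0.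
  by move=> a _; apply: leq_ltn_trans (dle a) (leq_ltn_trans Xn sizeR0).
move=> hi; have {hi} := leq_trans hi (leq_mul (leqnn l) (sum_dyadic_le X d i)).
set A := [seq a <- X | (2 ^ i <= d a < 2 ^ i.+1)%N].
set t := (2 ^ i)%N; rewrite dsum => /(leq_trans ptau) hA.
have tau0 : (0 < tau)%N by rewrite expn_gt0.
have t0 : (0 < t)%N by rewrite expn_gt0.
have A0 : (0 < size A)%N.
  rewrite lt0n; apply: contraTneq hA => ->.
  by rewrite mul0n muln0 -ltnNge muln_gt0 P0.
have uA : uniq A by apply: filter_uniq.
have AX : {subset A <= X} by move=> a; rewrite mem_filter => /andP[].
have AR : {subset A <= R0} by move=> a /AX/XR.
have An : (size A <= n)%N by apply: sub_size.
have ht : {in A, forall a, t <= \sum_(c <- R0) (op a c \in P)}%N.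
  move=> a; rewrite mem_filter => /andP[/andP[h _] _]; apply: leq_trans h _.
  exact: sum_sub_uniq.
have fAR : {subset map f A <= R0} by move=> _ /mapP[a /AR aR ->]; apply: f_R0.
have repA x : (rep op (map f A) R0 x <= size A)%N.
  by rewrite -(size_map f); apply: rep_le.
have [|x xS ->|k] := @dyadic_pigeonhole _ S (rep op (map f A) R0)
    (fun x => rep op (map f A) R0 x ^ 2)%N l l0.
- by move=> x _; apply: leq_ltn_trans (repA x) (leq_ltn_trans An sizeR0).
- by [].
move=> hk; have {hk} := leq_trans hk (leq_mul (leqnn l) (sum_dyadic_sqr_le S _
  k)).
set T0 := (2 ^ k)%N.
set Q := (\sum_(x <- S | T0 <= rep op (map f A) R0 x) rep op (map f A) R0 x)%N.
rewrite -/(energy _ _) => E2.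
have Qle : (Q <= size A * n)%N.
  apply: (@leq_trans (\sum_(x <- S) rep op (map f A) R0 x)%N).
    by rewrite /Q big_mkcond /=; apply: leq_sum => x _; case: ifP.
  by rewrite -(size_map f A); apply: sum_rep.
exists A; split=> //.
have nE : n%:R = nu ^+ 4 by rewrite nuE.
have ptau2 : (size P * tau <= n ^ 2)%N.
  apply: leq_trans ptau _; apply: (@leq_trans (size X * size X));
    last by rewrite -mulnn leq_mul.
  apply: leq_trans (sum_rep op X X uS).
  by rewrite big_filter big_mkcond /=; apply: leq_sum => x _; case: ifP.
have taun : (tau <= n)%N.
  have [x xP] : exists x, x \in P by move: P0; case: (P) => // x P' _;
    exists x; apply: mem_head.
  by move: xP; rewrite mem_filter => /andP[/andP[h _] _];
    apply: leq_trans h (repX x).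
rewrite /energy_scale.
apply: (@piece_energy_arith (energy X X)%:R _ (size P)%:R t%:R tau%:R);
  rewrite ?ltr0n ?ler1n //.
- by rewrite -!natrX -!natrM ler_nat; apply: leq_trans E1 _;
  rewrite !mulnA [(l * 4)%N]mulnC.
- rewrite -!natrM ler_nat; apply: leq_trans hA _.
  by rewrite (_ : l * (size A * (2 * t)) = 2 * l * size A * t)%N //; ring.
- by rewrite -natrM (_ : nu ^+ 8 = (n ^ 2)%:R) ?ler_nat // natrX nE -exprM.
- by rewrite -nE ler_nat.
have nn : nu ^+ 8 = n%:R ^+ 2 by rewrite nE -exprM.
have nn5 : nu ^+ 20 = n%:R ^+ 5 by rewrite nE -exprM.
have E2R : (energy (map f A) R0)%:R <= l%:R * (2 * T0%:R * Q%:R) :> R.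
  by rewrite -!natrM ler_nat.
have QR : Q%:R <= (size A)%:R * n%:R :> R by rewrite -natrM ler_nat.
(* The comparison says whether the threshold [t T0 / (2 n)] reaches the least richness [C2]. *)
have [h|h] := leP (2 * n%:R * C2) (t%:R * T0%:R).
  right; have := image_rep_bound uA uP AR t0 ht h; rewrite -/Q => h1.
  have g : (energy (map f A) R0)%:R ^+ 2 <= (l%:R * (2 * T0%:R * Q%:R)) ^+ 2 :>
    R.
    by rewrite lerXn2r // nnegrE ?mulr_ge0.
  apply: le_trans (ler_wpM2r _ g) _; first exact: exprn_ge0.
  have -> : (l%:R * (2 * T0%:R * Q%:R)) ^+ 2 * t%:R ^+ 3 =
    4 * l%:R ^+ 2 * (Q%:R * (Q%:R * T0%:R ^+ 2 * t%:R ^+ 3)) :> R by ring.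
  have -> : 32 * l%:R ^+ 2 * C3 * (size A)%:R * (size P)%:R ^+ 2 * nu ^+ 20 =
    4 * l%:R ^+ 2 * ((size A)%:R * n%:R * (8 * C3 * (size P)%:R ^+ 2 * n%:R ^+
      4)) :> R.
    by rewrite nn5; ring.
  apply: ler_wpM2l; first by rewrite mulr_ge0 ?exprn_ge0.
  by apply: ler_pM => //; rewrite !mulr_ge0 ?exprn_ge0.
left; apply: le_trans (ler_wpM2r _ E2R) _ => //.
have -> : l%:R * (2 * T0%:R * Q%:R) * t%:R = 2 * l%:R * (Q%:R * (t%:R * T0%:R))
  :> R by ring.
have -> : 4 * C2 * l%:R * nu ^+ 8 * (size A)%:R =
  2 * l%:R * (((size A)%:R * n%:R) * (2 * n%:R * C2)) :> R by rewrite nn; ring.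
apply: ler_wpM2l; first by rewrite mulr_ge0.
by apply: ler_pM => //; [rewrite mulr_ge0|apply: ltW].
Qed.

Lemma energy_scale_gt0 : 0 < energy_scale.
Proof.
have l0 : 0 < l%:R :> R by rewrite ltr0n l_gt0.
rewrite /energy_scale !mulr_gt0 ?exprn_gt0 ?(lt_le_trans ltr01 nu_ge1) //.
by have := C2_gt0; have := C3_ge1; lra.
Qed.

(* Weighted AM-GM: 2 u v <= (b / a) u ^ 2 + (a / b) v ^ 2. *)
Lemma sum_sqrD_le (M a b : R) (u v : T -> nat) : 0 < a -> 0 < b ->
  (\sum_(x <- S) u x ^ 2)%N%:R <= M * a ^+ 2 ->
  (\sum_(x <- S) v x ^ 2)%N%:R <= M * b ^+ 2 ->
  (\sum_(x <- S) (u x + v x) ^ 2)%N%:R <= M * (a + b) ^+ 2.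
Proof.
move=> a0 b0 hu hv.
have h : (\sum_(x <- S) (u x + v x) ^ 2)%N%:R <= (1 + b / a) * (\sum_(x <- S) u
  x ^ 2)%N%:R
    + (1 + a / b) * (\sum_(x <- S) v x ^ 2)%N%:R.
  rewrite !natr_sum !mulr_sumr -big_split /=; apply: ler_sum => x _.
  rewrite !natrX natrD; move: (u x)%:R (v x)%:R => p q.
  have : 0 <= (b * p - a * q) ^+ 2 / (a * b).
    by rewrite divr_ge0 ?sqr_ge0 // mulr_ge0 // ltW.
  have -> : (b * p - a * q) ^+ 2 / (a * b) = b / a * p ^+ 2 + a / b * q ^+ 2 -
    2 * p * q.
    by field; rewrite !gt_eqF.
  lra.
have ba : 0 <= 1 + b / a by rewrite addr_ge0 // divr_ge0 // ltW.
have ab : 0 <= 1 + a / b by rewrite addr_ge0 // divr_ge0 // ltW.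
apply: le_trans h _; apply: le_trans (lerD (ler_wpM2l ba hu) (ler_wpM2l ab hv))
  _.
rewrite le_eqVlt; apply/orP; left; apply/eqP; field.
by rewrite !gt_eqF.
Qed.

Lemma small_energy_half : exists Y, [/\ uniq Y, {subset Y <= R0},
  (size R0 <= 2 * size Y)%N &
  (energy Y Y)%:R <= (64 * C3 + 32 * C2) * l%:R ^+ 4 * nu ^+ 11].
Proof.
pose good B := [/\ uniq B, {subset B <= R0} &
  (energy (map f B) R0)%:R <= energy_scale * (size B)%:R ^+ 2].
pose p m := `[< exists2 B, good B & size B = m >].
have p0 : exists m, p m.
  exists 0%N; apply/asboolP; exists [::] => //; split=> //.
  rewrite /energy big1 => [|x _]; last by rewrite /rep big_nil.
  by apply: mulr_ge0; [apply/ltW/energy_scale_gt0|apply: exprn_ge0].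
have pn m : p m -> (m <= n)%N by move/asboolP => [B [uB BR _] <-];
  apply: sub_size.
case: (ex_maxnP p0 pn) => m /asboolP[B [uB BR EB] sB] Bmax.
have nuX (k : nat) : 1 <= nu ^+ k by apply: exprn_ege1.
have const1 : 1 <= (64 * C3 + 32 * C2) * l%:R ^+ 4.
  rewrite mulr_ege1 ?exprn_ege1 ?ler1n ?l_gt0 //.
  by have := C2_gt0; have := C3_ge1; lra.
have fBR : {subset map f B <= R0} by move=> _ /mapP[a /BR aR ->]; apply: f_R0.
have ufB : uniq (map f B).
  by rewrite map_inj_in_uniq // => a b /BR aR /BR bR; apply: f_inj.
have [h|h] := leqP (size R0) (2 * size B).
  exists (map f B); split=> //; first by rewrite size_map.
  apply: (@le_trans _ _ (energy (map f B) R0)%:R).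
    by rewrite ler_nat; apply: leq_sum => x _; rewrite leq_exp2r // rep_sub.
  apply: le_trans EB _.
  (* Since n = nu^4, the factor [nu ^+ 3] of the scale becomes nu^3 n^2 = nu^11. *)
  apply: (@le_trans _ _ (energy_scale * n%:R ^+ 2)).
    apply: ler_wpM2l; first exact/ltW/energy_scale_gt0.
    by rewrite lerXn2r ?nnegrE ?ler0n // ler_nat sub_size.
  rewrite /energy_scale -nuE; rewrite le_eqVlt; apply/orP; left; apply/eqP;
    ring.
pose X := [seq x <- R0 | x \notin B].
have uX : uniq X by apply: filter_uniq.
have XR : {subset X <= R0} by move=> x; rewrite mem_filter => /andP[].
have sX : (size X + size B = size R0)%N.
  rewrite addnC -size_cat; apply/perm_size/uniq_perm => //.
    rewrite cat_uniq uB uX andbT /= -all_predC; apply/allP => x.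
    by rewrite mem_filter => /andP[].
  move=> x; rewrite mem_cat mem_filter.
  by case: (boolP (x \in B)) => //= /BR ->.
have [hE|hE] := leP (energy X X)%:R (nu ^+ 11).
  exists X; split=> //; first by lia.
  by apply: le_trans hE _; rewrite ler_peMl // (le_trans ler01).
have [A [A0 uA AX EA]] := exists_structured_piece uX XR hE.
(* The weighted inequality [sum_sqrD_le] divides by both sizes, so an empty [B] is treated apart. *)
have [B0|B0] := posnP (size B).
  have : p (size A).
    by apply/asboolP; exists A => //; split=> // a /AX/XR.
  by move/Bmax; rewrite -sB B0 leqNgt A0.
have : p (size (B ++ A)).
  apply/asboolP; exists (B ++ A) => //; split.
  - rewrite cat_uniq uB uA andbT /= -all_predC; apply/allP => x /AX.
    by rewrite mem_filter => /andP[].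
  - by move=> x; rewrite mem_cat => /orP[/BR|/AX/XR].
  rewrite size_cat natrD map_cat /energy.
  under eq_bigr do rewrite rep_cat.
  by apply: sum_sqrD_le; rewrite ?ltr0n.
by move/Bmax; rewrite size_cat -sB -[leqRHS]addn0 leq_add2l leqNgt A0.
Qed.

End StructuredPieces.

Section FsetEnergy.
Local Open Scope fset_scope.
Local Open Scope nat_scope.

Variables (K : choiceType) (op : K -> K -> K).

Lemma card_quadruples_le (X : {fset K}) (s S : seq K) : uniq S -> X =i s ->
  {in s &, forall a b, op a b \in S} ->
  #|` [fset q in X `*` X `*` X `*` X |
        let: (x1, x2, x3, x4) := q in op x1 x3 == op x2 x4] |
  <= \sum_(x <- S) rep op s s x ^ 2.
Proof.
move=> uS Xs sS.
pose t := [seq (p.1.1, p.2.1, p.1.2, p.2.2) | p <-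
  [seq (p, p') | p <- [seq (a, b) | a <- s, b <- s],
                 p' <- [seq (a, b) | a <- s, b <- s]] & op p.1.1 p.1.2 == op
                   p.2.1 p.2.2].
apply: (@leq_trans (size t)).
  apply: uniq_leq_size; first exact: fset_uniq.
  move=> [[[x1 x2] x3] x4]; rewrite !inE /= => /andP[/andP[/andP[/andP[h1 h2]
    h3] h4] e].
  apply/mapP; exists ((x1, x3), (x2, x4)) => //; rewrite mem_filter e /=.
  by rewrite allpairs_f //; apply: allpairs_f; rewrite -Xs.
rewrite size_map size_filter -sum1_count big_mkcond /= big_allpairs /=
  big_allpairs /=.
under eq_bigr => a _ do under eq_bigr => b _ do rewrite big_allpairs /=.
rewrite [leqRHS](_ : _ = \sum_(x <- S) \sum_(a <- s) \sum_(b <- s) \sum_(c <-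
  s) \sum_(d <- s)
   ((op a b == x) && (op c d == x) : nat)); last first.
  apply: eq_bigr => x _; rewrite -mulnn {1}/rep big_distrl /=;
    apply: eq_bigr => a _.
  rewrite big_distrl /=; apply: eq_bigr => b _; rewrite /rep big_distrr /=.
  apply: eq_bigr => c _; rewrite big_distrr /=; apply: eq_bigr => d _.
  by case: eqP; case: eqP.
rewrite [leqRHS]exchange_big /= big_seq [leqRHS]big_seq; apply: leq_sum => a aS.
rewrite [leqRHS]exchange_big /= big_seq [leqRHS]big_seq; apply: leq_sum => b bS.
rewrite [leqRHS]exchange_big /=; apply: leq_sum => c _.
rewrite [leqRHS]exchange_big /=; apply: leq_sum => d _.
case: eqP => // <-; rewrite (big_rem (op a b)) ?sS //= eqxx.
by [].
Qed.

(** Serves to put back one element removed from the ratio set, without which half of its size might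
    be missed. The new element adds at most one representation on each side. *)
Lemma energy_cons_le (S Y : seq K) (e : K) : uniq S -> uniq (e :: Y) ->
  {in e :: Y, forall a, {in e :: Y &, injective (op a)}} ->
  {in Y &, injective (op^~ e)} ->
  \sum_(x <- S) rep op (e :: Y) (e :: Y) x ^ 2 <=
  2 * \sum_(x <- S) rep op Y Y x ^ 2 + 8 * (size Y).+1 ^ 2.
Proof.
move=> uS ueY injr injl; have /andP[eY uY] := ueY.
have step x : rep op (e :: Y) (e :: Y) x <= rep op Y Y x + 2.
  rewrite {1}/rep big_cons.
  have h1 : \sum_(b <- e :: Y) (op e b == x : nat) <= 1.
    apply: sum_le1 => // b b' bY b'Y /eqP h /eqP h'.
    by apply: (injr e (mem_head _ _)) => //; rewrite h h'.
  have h2 : \sum_(a <- Y) \sum_(b <- e :: Y) (op a b == x : nat) <= 1 + rep op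
    Y Y x.
    under eq_bigr do rewrite big_cons; rewrite big_split /= leq_add2r.
    apply: sum_le1 => // a a' aY a'Y /eqP h /eqP h'.
    by apply: injl => //; rewrite h h'.
  by apply: leq_trans (leq_add h1 h2) _; rewrite addnA addnC.
apply: (@leq_trans (\sum_(x <- S) (2 * rep op Y Y x ^ 2 + 8 * rep op (e :: Y)
  (e :: Y) x))).
  apply: leq_sum => x _; have := step x.
  (* For a new count of 0 the left side vanishes. Otherwise, with r the old count, (r + 2)^2 <= 2
     r^2 + 8 is (r - 2)^2 >= 0. *)
  case: (rep op (e :: Y) _ x) => [|k] h; first by rewrite exp0n.
  apply: (@leq_trans ((rep op Y Y x + 2) ^ 2)); first by rewrite leq_exp2r.
  by clear; move: (rep _ _ _ _) => [|[|r]]; rewrite -?mulnn; nia.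
rewrite big_split /= -!big_distrr /= leq_add2l leq_mul2l /=.
by rewrite -mulnn; apply: sum_rep.
Qed.

End FsetEnergy.

Section HalfEnergy.

Variable R : realType.

(** The 16 is 2 * 8, with 2 from [energy_cons_le] and 8 from [powR_double_le]; the last 8 is the
    linear term of [energy_cons_le]. *)
Definition energy_constant : R :=
  16 * (64 * incidence_constant R + 32 * min_richness R) + 8.

Lemma min_richness_gt0 : 0 < min_richness R.
Proof.
rewrite mulr_gt0 // ltr0n; apply/card_gt0P.
by exists (true, (true, true), (true, true),
  (None, (ord0, ord0, ord0), (ord0, ord0, ord0))).
Qed.

Lemma incidence_constant_ge1 : 1 <= incidence_constant R.
Proof.
rewrite /incidence_constant mulr_ege1 //; first by rewrite mulr_ege1
  ?exprn_ege1 ?ler1n.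
by rewrite exprn_ege1 // ler1n addn1.
Qed.

Lemma energy_constant_ge0 : 0 <= energy_constant.
Proof.
by rewrite addr_ge0 // mulr_ge0 // addr_ge0 // mulr_ge0 // ltW //
  ?min_richness_gt0 // (lt_le_trans ltr01 incidence_constant_ge1).
Qed.

Lemma powR_double_le (n m : nat) : (n <= 2 * m)%N ->
  n%:R `^ (11 / 4) <= 8 * m%:R `^ (11 / 4) :> R.
Proof.
move=> nm; apply: (@le_trans _ _ ((2 * m%:R) `^ (11 / 4))).
  apply: ge0_ler_powR; rewrite ?nnegrE ?mulr_ge0 //; first by lra.
  by rewrite -natrM ler_nat.
rewrite powRM // ler_wpM2r ?powR_ge0 //.
apply: (@le_trans _ _ (2 `^ 3%:R)); first by rewrite ler_powR //; lra.
by rewrite powR_mulrn // -natrX ler_nat.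
Qed.

Variables (op : R[i] -> R[i] -> R[i]) (f : R[i] -> R[i]) (e : R[i]).
Variables (R0 S : seq R[i]).
Hypotheses (ueR0 : uniq (e :: R0)) (uS : uniq S).
Hypothesis op_S : {in e :: R0 &, forall a b, op a b \in S}.
Hypothesis op_injr : {in e :: R0, forall a, {in e :: R0 &, injective (op a)}}.
Hypothesis op_injl : {in R0 &, injective (op^~ e)}.
Hypothesis f_R0 : {in R0, forall a, f a \in R0}.
Hypothesis f_inj : {in R0 &, injective f}.
Hypothesis incidences : forall A P : seq R[i], uniq A -> uniq P ->
  {subset A <= R0} -> forall kap : R, 0 < kap -> min_richness R <= kap ->
  (\sum_(c <- R0) \sum_(x <- S)
     (if kap <= (richness op f R0 A P c x)%:R
      then (richness op f R0 A P c x)%:R else 0)) * kap ^+ 2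
  <= incidence_constant R * (size P)%:R ^+ 2 * (size R0)%:R ^+ 2.

Lemma exists_half_energy (l : nat) : (size R0 < 2 ^ l)%N -> (0 < l)%N ->
  exists X : {fset R[i]}, [/\ {subset X <= e :: R0},
    (size R0 + 2 <= 2 * #|` X|)%N &
    #|` [fset q in X `*` X `*` X `*` X |
        let: (x1, x2, x3, x4) := q in op x1 x3 == op x2 x4] |%fset%:R
    <= energy_constant * l%:R ^+ 4 * #|` X|%:R `^ (11 / 4)].
Proof.
move=> nl l0; have /andP[eR0 uR0] := ueR0.
have sub : {subset R0 <= e :: R0} by move=> x xR; rewrite inE xR orbT.
set c := 64 * incidence_constant R + 32 * min_richness R.
have c0 : 0 < c by have := min_richness_gt0; have := incidence_constant_ge1;
  rewrite /c; lra.
have [Y [uY YR nY EY]] : exists Y, [/\ uniq Y, {subset Y <= R0},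
    (size R0 <= 2 * size Y)%N &
    (\sum_(x <- S) rep op Y Y x ^ 2)%N%:R <=
      c * l%:R ^+ 4 * (size R0)%:R `^ (11 / 4)].
  (* [nu >= 1] needs a nonempty [R0]; on the multiplicative side it is empty when the ratio set is
     {0, 1}. *)
  have [n0|n0] := posnP (size R0).
    exists [::]; split=> //; first by rewrite n0.
    rewrite big1 => [|x _]; last by rewrite /rep big_nil.
    by rewrite !mulr_ge0 ?exprn_ge0 ?powR_ge0 // ltW.
  pose nu : R := (size R0)%:R `^ (1 / 4).
  have nu1 : 1 <= nu.
    rewrite /nu -[leLHS](powRr0 (size R0)%:R) ler_powR ?ler1n //; lra.
  have nuX (k : nat) : nu ^+ k = (size R0)%:R `^ (1 / 4 * k%:R).
    by rewrite -powR_mulrn ?powR_ge0 // -powRrM.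
  have nu4 : nu ^+ 4 = (size R0)%:R.
    by rewrite nuX (_ : 1 / 4 * 4 = 1) ?powRr1 //; lra.
  have op_injr' : {in R0, forall a, {in R0 &, injective (op a)}}.
    by move=> a /sub aR b b' /sub bR /sub b'R; apply: op_injr.
  have [Y [uY YR nY EY]] := small_energy_half uR0 uS op_injr' f_R0 f_inj
    min_richness_gt0 incidence_constant_ge1 nu1 nu4 nl incidences.
  exists Y; split=> //; apply: le_trans EY _.
  by rewrite nuX (_ : 1 / 4 * 11 = 11 / 4) //; lra.
have ueY : uniq (e :: Y).
  by rewrite cons_uniq uY andbT; apply/negP => /YR h; rewrite h in eR0.
have YR1 : {subset e :: Y <= e :: R0}.
  by move=> x; rewrite !inE => /orP[->//|/YR ->]; rewrite orbT.
exists [fset x in e :: Y]%fset.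
have Xs : [fset x in e :: Y]%fset =i e :: Y by move=> x; rewrite !inE.
have cX : #|` [fset x in e :: Y]%fset| = (size Y).+1.
  by rewrite card_fseq undup_id.
rewrite cX; split.
- by move=> x; rewrite Xs => /YR1.
- lia.
have h1 := card_quadruples_le uS Xs (fun a b aY bY => op_S (YR1 a aY) (YR1 b
  bY)).
have h2 : (\sum_(x <- S) rep op (e :: Y) (e :: Y) x ^ 2 <=
  2 * \sum_(x <- S) rep op Y Y x ^ 2 + 8 * (size Y).+1 ^ 2)%N.
  apply: energy_cons_le => //.
    by move=> a /YR1 aR b b' /YR1 bR /YR1 b'R; apply: op_injr.
  by move=> a b /YR aR /YR bR; apply: op_injl.
have := leq_trans h1 h2; rewrite -(ler_nat R) => /le_trans; apply.
rewrite natrD natrM (natrM _ 8) natrX.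
set m := (size Y).+1.
have g1 : (size R0)%:R `^ (11 / 4) <= 8 * m%:R `^ (11 / 4) :> R.
  by apply: powR_double_le; rewrite /m; lia.
have g2 : m%:R ^+ 2 <= m%:R `^ (11 / 4) :> R.
  by rewrite -powR_mulrn // ler_powR ?ler1n //; lra.
have l1 : 1 <= l%:R ^+ 4 :> R by rewrite exprn_ege1 // ler1n.
have g3 : m%:R `^ (11 / 4) <= l%:R ^+ 4 * m%:R `^ (11 / 4) :> R.
  by rewrite ler_peMl // powR_ge0.
have g4 : c * l%:R ^+ 4 * (size R0)%:R `^ (11 / 4) <=
    c * l%:R ^+ 4 * (8 * m%:R `^ (11 / 4)).
  by rewrite ler_wpM2l // mulr_ge0 ?exprn_ge0 // ltW.
rewrite /energy_constant -/c.
have -> : (16 * c + 8) * l%:R ^+ 4 * m%:R `^ (11 / 4) =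
  2 * (c * l%:R ^+ 4 * (8 * m%:R `^ (11 / 4))) + 8 * (l%:R ^+ 4 * m%:R `^ (11 /
    4)) by ring.
lra.
Qed.

End HalfEnergy.

(** * The set of ratios *)

Section Instances.

Variable R : realType.

Lemma mul_incidences (R0 S : seq R[i]) : uniq R0 -> uniq S ->
  0 \notin R0 -> 1 \notin R0 -> 0 \notin S ->
  forall A P : seq R[i], uniq A -> uniq P ->
  {subset A <= R0} -> forall kap : R, 0 < kap -> min_richness R <= kap ->
  (\sum_(c <- R0) \sum_(x <- S)
     (if kap <= (richness *%R (fun x : R[i] => 1 - x) R0 A P c x)%:R
      then (richness *%R (fun x : R[i] => 1 - x) R0 A P c x)%:R else 0)) * kap
        ^+ 2
  <= incidence_constant R * (size P)%:R ^+ 2 * (size R0)%:R ^+ 2.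
Proof.
move=> uR0 uS R00 R01 S0 A P uA uP AR kap kap0 hk.
have nz x : x \in R0 -> x != 0 by apply: contraTneq => ->.
have n1 x : x \in R0 -> 1 - x != 0.
  by apply: contraTneq => /eqP; rewrite subr_eq0 => /eqP <-.
apply: (@incidence_bound _ _ _ (fun b => b^-1) (fun x a => (1 - a) / x)) => //.
- by move=> u /AR/nz u0 c c' _ _; apply: mulfI.
- by move=> c /nz c0 u v _ _; apply: mulIf.
- by move=> b b' _ _; apply: invr_inj.
- move=> a b /AR aR bR x <-.
  by field; rewrite n1 // nz.
- move=> c x /nz c0 xS; left.
  have x0 : x != 0 by apply: contraTneq xS => ->.
  exists (normc c * normc x)^-1; first by rewrite invr_gt0 mulr_gt0 ?normc_gt0.
  move=> u v _ _; rewrite -mulrBl -mulrBl !ComplexField.Normc.normcM.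
  have -> : 1 - u - (1 - v) = - (u - v) by ring.
  rewrite normcN ComplexField.Normc.normcV; field.
  by rewrite !gt_eqF ?normc_gt0.
- move=> p p' b b' bR b'R.
  (* This is [c * u * ((1 - v) * b' - (1 - u) * b)] with [c] and [v] eliminated through [p = u * c]
     and [p' = v * c]. *)
  pose q : {poly R[i]} := Poly [:: - (p * (b - b')); p * b - p' * b'].
  have sq : (size q <= 3)%N by apply: leq_trans (size_Poly _) _.
  have [q0|q0] := eqVneq q 0; last first.
    exists q => //; split=> // u v c uA' vA cR uv up vp e.
    rewrite /root /q horner_Poly /=.
    have -> : ((0 * u + (p * b - p' * b')) * u + - (p * (b - b'))) =
      c * u * ((1 - v) * b' - (1 - u) * b) by rewrite -up -vp; ring.
    by rewrite e subrr mulr0.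
  (* If both coefficients vanish, then [b = b'] and [p = p'], hence [u = v]: no triple exists, and a
     polynomial without roots serves. *)
  exists 1; first exact: oner_neq0.
  split; first by rewrite size_poly1.
  move=> u v c uA' vA cR uv up vp e; exfalso.
  have /(congr1 (coefp 0)) /= : q = 0 by [].
  have /(congr1 (coefp 1)) /= : q = 0 by [].
  rewrite !coef_Poly !coef0 /= => /eqP h1 /eqP.
  have p0 : p != 0 by rewrite -up mulf_neq0 // nz // AR.
  rewrite oppr_eq0 mulf_eq0 (negbTE p0) subr_eq0 /= => /eqP bb.
  move: h1; rewrite -bb -mulrBl mulf_eq0 (negbTE (nz _ bR)) orbF subr_eq0 -up
    -vp.
  by move/eqP/(mulIf (nz _ cR)) => euv; rewrite euv eqxx in uv.
Qed.

Lemma add_incidences (R0 S : seq R[i]) : uniq R0 -> uniq S -> 0 \notin R0 ->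
  forall A P : seq R[i], uniq A -> uniq P ->
  {subset A <= R0} -> forall kap : R, 0 < kap -> min_richness R <= kap ->
  (\sum_(c <- R0) \sum_(x <- S)
     (if kap <= (richness +%R (fun x : R[i] => x^-1) R0 A P c x)%:R
      then (richness +%R (fun x : R[i] => x^-1) R0 A P c x)%:R else 0)) * kap
        ^+ 2
  <= incidence_constant R * (size P)%:R ^+ 2 * (size R0)%:R ^+ 2.
Proof.
move=> uR0 uS R00 A P uA uP AR kap kap0 hk.
have nz x : x \in R0 -> x != 0 by apply: contraTneq => ->.
apply: (@incidence_bound _ _ _ (fun b => - b) (fun x a => a^-1 - x)) => //.
- by move=> u _ c c' _ _ /addrI.
- by move=> c _ u v _ _ /addIr.
- by move=> b b' _ _; apply: oppr_inj.
- by move=> a b _ _ x <-; rewrite opprD addrA subrr add0r.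
- move=> c x _ _; right; exists c, (- x) => v.
  by rewrite mem_filter => /andP[_ /AR/nz v0].
- move=> p p' b b' bR b'R; pose s := p - p'; pose w := b' - b.
  have [s0|s0] := eqVneq s 0.
    exists 1; first exact: oner_neq0.
    split; first by rewrite size_poly1.
    move=> u v c _ _ _ uv up vp _; exfalso; move/eqP: s0;
      rewrite subr_eq0 -up -vp.
    by move/eqP/addIr => euv; rewrite euv eqxx in uv.
  (* From [s = u - v] and [w = u^-1 - v^-1] follows [w * u * v + s = 0]; replacing [v] by [u - s]
     gives this quadratic. *)
  exists (Poly [:: s; - (w * s); w]).
    apply: contraNneq s0 => q0; have := coef_Poly [:: s; - (w * s); w] 0.
    by rewrite q0 coef0 /= => <-.
  split; first exact: size_Poly.
  move=> u v c /AR/nz u0 /AR/nz v0 _ uv up vp e.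
  rewrite /root horner_Poly /=.
  have sE : s = u - v by rewrite /s -up -vp; ring.
  have wE : w = u^-1 - v^-1 by rewrite /w; apply/eqP;
    rewrite subr_eq addrAC e addrAC subrr add0r.
  by rewrite sE wE; apply/eqP; field; rewrite u0 v0.
Qed.

End Instances.

Section RatioSet.

Variables (K : fieldType) (A : {fset K}).

Lemma ratio_setP x : reflect
  (exists a a1 a2, [/\ a \in A, a1 \in A, a2 \in A, a2 != a &
    x = (a1 - a) / (a2 - a)]) (x \in ratio_set A).
Proof.
apply: (iffP (imfsetP _ _ _ _)) => /= [[[[a a1] a2]]|[a [a1 [a2 [aA a1A a2A ne
  ->]]]]].
  rewrite !inE /= => /andP[/andP[/andP[aA a1A] a2A] ne] ->.
  by exists a, a1, a2.
by exists (a, a1, a2) => //; rewrite !inE /= aA a1A a2A.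
Qed.

(** Exchanging [a] with [a2] turns a ratio into one minus it; in the next lemma, exchanging [a1]
    with [a2] inverts it. *)
Lemma ratio_set1B x : x \in ratio_set A -> 1 - x \in ratio_set A.
Proof.
move=> /ratio_setP[a [a1 [a2 [aA a1A a2A ne ->]]]].
apply/ratio_setP; exists a2, a1, a; split=> //; first by rewrite eq_sym.
by field; rewrite !subr_eq0 ne eq_sym ne.
Qed.

Lemma ratio_setV x : x \in ratio_set A -> x != 0 -> x^-1 \in ratio_set A.
Proof.
move=> /ratio_setP[a [a1 [a2 [aA a1A a2A ne ->]]]] x0.
apply/ratio_setP; exists a, a2, a1; split=> //; last by rewrite invf_div.
by apply: contraNneq x0 => ->; rewrite subrr mul0r.
Qed.

Lemma ratio_set01 : (1 < #|` A|)%N -> 0 \in ratio_set A /\ 1 \in ratio_set A.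
Proof.
move=> A2; have [a [b [aA bA ne]]] : exists a b, [/\ a \in A, b \in A & b != a].
  have /fset0Pn[a aA] : A != fset0 by rewrite -cardfs_gt0 ltnW.
  have /fset0Pn[b] : (A `\ a)%fset != fset0.
    by rewrite -cardfs_gt0; move: A2; rewrite (cardfsD1 a) aA ltnS.
  by rewrite !inE => /andP[ne bA]; exists a, b.
split; apply/ratio_setP.
  by exists a, a, b; split=> //; rewrite subrr mul0r.
by exists a, b, b; split=> //; rewrite divff // subr_eq0.
Qed.

Lemma card_ratio_set_le : (#|` ratio_set A| <= #|` A| ^ 3)%N.
Proof.
pose s := [seq (t.1.2 - t.1.1) / (t.2 - t.1.1) |
  t <- [seq (p, c) | p <- [seq (a, b) | a <- A, b <- A], c <- A]].
apply: (@leq_trans (size s)).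
  apply: uniq_leq_size; first exact: fset_uniq.
  move=> x /ratio_setP[a [a1 [a2 [aA a1A a2A _ ->]]]].
  apply/mapP; exists (a, a1, a2) => //.
  by apply: allpairs_f => //; apply: allpairs_f.
by rewrite size_map !size_allpairs !expnS expn0 muln1 mulnA.
Qed.

End RatioSet.

Section Half.

Variables (R : realType) (A : {fset R[i]}).
Hypothesis A_gt1 : (1 < #|` A|)%N.

Let log_A : R := log2 #|` A|%:R.

Lemma log_ge1 : 1 <= log_A.
Proof.
by rewrite /log_A /log2 ler_pdivlMr ?mul1r ?ln_gt0 ?ltr1n // ler_ln ?posrE
  ?ltr0n ?ler_nat // ltnW.
Qed.

Lemma exists_binary_length : exists l : nat, [/\ (0 < l)%N,
  (#|` ratio_set A| < 2 ^ l)%N & l%:R <= 6 * log_A].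
Proof.
(* The length is tripled because the ratio set has at most |A|^3 elements; as [log_A >= 1], k is at
   most twice [log_A]. *)
pose k := (trunc_log 2 #|` A|).+1.
have Ak : (#|` A| < 2 ^ k)%N by rewrite trunc_log_ltn.
exists (k * 3)%N; split=> //.
  apply: leq_ltn_trans (card_ratio_set_le A) _.
  by rewrite expnM ltn_exp2r.
have ln2 : 0 < ln 2 :> R by rewrite ln_gt0 // ltr1n.
have h : (trunc_log 2 #|` A|)%:R <= log_A.
  rewrite /log_A /log2 ler_pdivlMr // mulr_natl -lnXn //.
  rewrite ler_ln ?posrE ?exprn_gt0 ?ltr0n ?(ltnW A_gt1) //.
  by rewrite -natrX ler_nat trunc_logP // ltnW.
have -> : (k * 3)%:R = ((trunc_log 2 #|` A|)%:R + 1) * 3 :> R by rewrite natrM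
  natr1.
by have := log_ge1; lra.
Qed.

(** Here 1296 = 6^4, and [log_A >= 1] lets the fourth power be raised to any exponent [C0 >= 4]. *)
Lemma polylog_le_energy (c C0 U V : R) (l : nat) : 0 <= c -> 0 <= V ->
  1296 * c <= C0 -> 4 <= C0 -> l%:R <= 6 * log_A ->
  U <= c * l%:R ^+ 4 * V -> polylog_le C0 #|` A| U V.
Proof.
move=> c0 V0 cC C4 hl hU; rewrite /polylog_le -/log_A; apply: le_trans hU _.
apply: ler_wpM2r => //.
have L1 := log_ge1; have L0 : 0 <= log_A by apply: le_trans L1.
have h1 : l%:R ^+ 4 <= (6 * log_A) ^+ 4.
  by apply: lerXn2r => //; rewrite nnegrE; [apply: ler0n|apply: mulr_ge0].
have h2 : log_A ^+ 4 <= log_A `^ C0.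
  by rewrite -powR_mulrn // ler_powR.
apply: le_trans (ler_wpM2l c0 h1) _.
have -> : c * (6 * log_A) ^+ 4 = 1296 * c * log_A ^+ 4 by ring.
by apply: ler_pM => //; [apply: mulr_ge0|apply: exprn_ge0].
Qed.

Lemma card_half_le (m k : nat) : (m <= 2 * k)%N -> m%:R / 2 <= k%:R :> R.
Proof. by rewrite -(ler_nat R) natrM => h; lra. Qed.

Lemma exists_mul_half (C0 : R) : 1296 * energy_constant R <= C0 -> 4 <= C0 ->
  exists X : {fset R[i]}, [/\ (X `<=` ratio_set A)%fset,
    #|` ratio_set A|%:R / 2 <= #|` X|%:R :> R &
    polylog_le C0 #|` A| (multiplicative_energy X)%:R
      (#|` X|%:R `^ (3 - 1 / 4))].
Proof.
move=> hC C4; have [Q0 Q1] := ratio_set01 A_gt1.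
have [l [l0 lQ hl]] := exists_binary_length.
(* Both 0 and 1 are removed, so that products are cancellable and [1 - a] stays in [R0]. Putting 1
   back into the half makes up for the two removed elements. *)
pose R0 := [seq x <- ratio_set A | (x != 0) && (x != 1)].
pose S := [seq x <- undup [seq a * b | a <- 1 :: R0, b <- 1 :: R0] | x != 0].
have uR0 : uniq R0 by rewrite filter_uniq ?fset_uniq.
have ueR0 : uniq (1 :: R0) by rewrite cons_uniq uR0 mem_filter eqxx andbF.
have uS : uniq S by rewrite filter_uniq ?undup_uniq.
have R1nz x : x \in 1 :: R0 -> x != 0.
  by rewrite inE mem_filter => /orP[/eqP->|/andP[/andP[]]] //; apply: oner_neq0.
have sQ : (size R0 + 2 = #|` ratio_set A|)%N.
  rewrite addn2 -[LHS]/(size (0 :: 1 :: R0)).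
  apply/perm_size/uniq_perm; rewrite ?fset_uniq //.
    rewrite cons_uniq ueR0 andbT; apply/negP => /R1nz; by rewrite eqxx.
  move=> x; rewrite !inE mem_filter.
  by case: eqVneq => [->|_]; case: eqVneq => [->|_] //=.
have op_S : {in 1 :: R0 &, forall a b, a * b \in S}.
  move=> a b aR bR; rewrite mem_filter mem_undup (mulf_neq0 (R1nz a aR) (R1nz b
    bR)).
  exact: allpairs_f.
have f_R0 : {in R0, forall a, 1 - a \in R0}.
  move=> a; rewrite !mem_filter => /andP[/andP[a0 a1] aQ].
  rewrite ratio_set1B // andbT subr_eq0 eq_sym a1 /=.
  by apply: contra a0 => /eqP e; rewrite -(subKr 1 a) e subrr.
have nl : (size R0 < 2 ^ l)%N by apply: leq_ltn_trans lQ; rewrite -sQ leq_addr.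
have R00 : 0 \notin R0 by rewrite mem_filter eqxx.
have R01 : 1 \notin R0 by rewrite mem_filter eqxx andbF.
have S0 : 0 \notin S by rewrite mem_filter eqxx.
have injr : {in 1 :: R0, forall a : R[i], {in 1 :: R0 &, injective ( *%R a)}}.
  by move=> a /R1nz a0 b c _ _; apply: mulfI.
have injl : {in R0 &, injective ( *%R^~ (1 : R[i]))}.
  by move=> a b _ _ /=; rewrite !mulr1.
have finj : {in R0 &, injective (fun x : R[i] => 1 - x)}.
  by move=> a b _ _ /addrI/oppr_inj.
have [X [XR sX EX]] := exists_half_energy ueR0 uS op_S injr injl f_R0 finj
  (mul_incidences uR0 uS R00 R01 S0) nl l0.
exists X; split.
- apply/fsubsetP => x /XR; rewrite inE mem_filter => /orP[/eqP->//|/andP[]//].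
- by apply: card_half_le; rewrite -sQ.
- rewrite (_ : 3 - 1 / 4 = 11 / 4); last by lra.
  by apply: (polylog_le_energy _ _ hC C4 hl EX);
    rewrite ?powR_ge0 ?energy_constant_ge0.
Qed.

Lemma exists_add_half (C0 : R) : 1296 * energy_constant R <= C0 -> 4 <= C0 ->
  exists X : {fset R[i]}, [/\ (X `<=` ratio_set A)%fset,
    #|` ratio_set A|%:R / 2 <= #|` X|%:R :> R &
    polylog_le C0 #|` A| (additive_energy X)%:R
      (#|` X|%:R `^ (3 - 1 / 4))].
Proof.
move=> hC C4; have [Q0 Q1] := ratio_set01 A_gt1.
have [l [l0 lQ hl]] := exists_binary_length.
(* Only 0 is removed, as inversion preserves the rest; it is put back into the half. *)
pose R0 := [seq x <- ratio_set A | x != 0].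
pose S := undup [seq a + b | a <- 0 :: R0, b <- 0 :: R0].
have uR0 : uniq R0 by rewrite filter_uniq ?fset_uniq.
have ueR0 : uniq (0 :: R0) by rewrite cons_uniq uR0 mem_filter eqxx.
have uS : uniq S by apply: undup_uniq.
have sQ : (size R0 + 1 = #|` ratio_set A|)%N.
  rewrite addn1 -[LHS]/(size (0 :: R0)).
  apply/perm_size/uniq_perm; rewrite ?fset_uniq //.
  move=> x; rewrite !inE mem_filter.
  by case: eqVneq => [->|_].
have op_S : {in 0 :: R0 &, forall a b, a + b \in S}.
  by move=> a b aR bR; rewrite mem_undup; apply: allpairs_f.
have f_R0 : {in R0, forall a, a^-1 \in R0}.
  by move=> a; rewrite !mem_filter invr_eq0 => /andP[a0 aQ];
    rewrite a0 ratio_setV.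
have nl : (size R0 < 2 ^ l)%N by apply: leq_ltn_trans lQ; rewrite -sQ leq_addr.
have R00 : 0 \notin R0 by rewrite mem_filter eqxx.
have injr : {in 0 :: R0, forall a : R[i], {in 0 :: R0 &, injective (+%R a)}}.
  by move=> a _ b c _ _ /addrI.
have injl : {in R0 &, injective (+%R^~ (0 : R[i]))}.
  by move=> a b _ _ /=; rewrite !addr0.
have finj : {in R0 &, injective (fun x : R[i] => x^-1)}.
  by move=> a b _ _ /invr_inj.
have [X [XR sX EX]] := exists_half_energy ueR0 uS op_S injr injl f_R0 finj
  (add_incidences uR0 uS R00) nl l0.
exists X; split.
- apply/fsubsetP => x /XR; rewrite inE mem_filter => /orP[/eqP->//|/andP[]//].
- by apply: card_half_le; rewrite -sQ; apply: leq_trans sX; rewrite leq_add2l.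
- rewrite (_ : 3 - 1 / 4 = 11 / 4); last by lra.
  by apply: (polylog_le_energy _ _ hC C4 hl EX);
    rewrite ?powR_ge0 ?energy_constant_ge0.
Qed.

End Half.

Local Open Scope fset_scope.
Local Open Scope complex_scope.

Theorem corollary10 (R : realType) :
  exists C0 : R, 0 < C0 /\
    forall A : {fset R[i]}, 0 \notin A -> (1 < #|` A|)%N ->
      exists R' R'' : {fset R[i]},
        [/\ R' `<=` ratio_set A,
            R'' `<=` ratio_set A,
            (#|` ratio_set A|%:R / 2 <= #|` R'|%:R :> R) /\
            (#|` ratio_set A|%:R / 2 <= #|` R''|%:R :> R),
            polylog_le C0 #|` A| (multiplicative_energy R')%:R
              (#|` R'|%:R `^ (3 - 1 / 4)) &
            polylog_le C0 #|` A| (additive_energy R'')%:R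
              (#|` R''|%:R `^ (3 - 1 / 4))].
Proof.
have c0 := energy_constant_ge0 R.
have [C0 [hC C4]] : exists C0 : R, (1296 * energy_constant R <= C0)%R /\ (4 <= C0)%R.
  exists (1296 * energy_constant R + 4)%R; rewrite lerDl lerDr; split=> //.
  exact: mulr_ge0.
exists C0; split; first exact: lt_le_trans C4.
move=> A _ A2.
have [X [XA cX EX]] := exists_mul_half A2 hC C4.
have [Y [YA cY EY]] := exists_add_half A2 hC C4.
by exists X, Y.
Qed.
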